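(* Let $A\in\mathbb{R}^{n\times d}$, $b\in\mathbb{R}^n$, $f(x):=\|Ax-b\|_2^2$ and $x^*=\arg\min_x f(x)$. For the Gaussian sketch $S\in\mathbb{R}^{m\times n}$ with $m>d+1$, the estimator $\hat{x}=\arg\min_x\|SAx-Sb\|_2^2$ satisfies $$\mathbb{E}\big[\|A(\hat{x}-x^* )\|_2^2\big]=\mathbb{E}[f(\hat{x})]-f(x^* )=f(x^* )\,\frac{d}{m-d-1}.$$
   Context: A Gaussian sketch is a random matrix $S\in\mathbb{R}^{m\times n}$ with i.i.d. zero-mean Gaussian entries, scaled so that $\mathbb{E}[S^TS]=I_n$ (that is, entries $\mathcal{N}(0,1/m)$). The expectation is over $S$ only; the data $A$ and $b$ are deterministic. *)

(* Defs.v *)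
From HB Require Import structures.
From mathcomp Require Import all_boot all_order all_algebra.
From mathcomp Require Import all_classical all_reals all_analysis.

Set Implicit Arguments.
Unset Strict Implicit.
Unset Printing Implicit Defensive.

Import Order.TTheory GRing.Theory Num.Theory.
Import numFieldNormedType.Exports.

Local Open Scope classical_set_scope.
Local Open Scope ring_scope.

(* Euclidean norm; the library's [`|v|] on matrices is the sup norm. *)
Definition norm2 (R : realType) (k : nat) (v : 'cV[R]_k) : R :=
  Num.sqrt (\sum_(i < k) v i 0 ^+ 2).

Definition lsq (R : realType) (n d : nat) (A : 'M[R]_(n, d)) (b : 'cV[R]_n)
    (x : 'cV[R]_d) : R :=
  norm2 (A *m x - b) ^+ 2.

Definition argmin (R : realType) (T : Type) (f : T -> R) : set T :=
  [set x | forall y, f x <= f y].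

Definition mutually_independent (disp : measure_display)
    (T : measurableType disp) (R : realType) (P : probability T R)
    (I : finType) (X : I -> {RV P >-> R}) : Prop :=
  forall (J : {set I}) (B : I -> set R),
    (forall i, i \in J -> measurable (B i)) ->
    P (\bigcap_(i in [set` J]) (X i @^-1` B i)) =
    (\prod_(i in J) P (X i @^-1` B i))%E.

(* The second parameter of [normal_prob] is the standard deviation, so entries
   have variance 1/m.  Laws are compared on measurable sets only: both sides
   also take (meaningless) values on non-measurable sets. *)
Definition gaussian_sketch (disp : measure_display)
    (T : measurableType disp) (R : realType) (P : probability T R)
    (m n : nat) (S : 'I_m -> 'I_n -> {RV P >-> R}) : Prop :=
  (forall i j (B : set R), measurable B ->
     distribution P (S i j) B = normal_prob 0 (Num.sqrt (m%:R^-1)) B) /\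
  mutually_independent (fun ij : 'I_m * 'I_n => S ij.1 ij.2).

Definition sketch_mx (disp : measure_display)
    (T : measurableType disp) (R : realType) (P : probability T R)
    (m n : nat) (S : 'I_m -> 'I_n -> {RV P >-> R}) (w : T) : 'M[R]_(m, n) :=
  \matrix_(i < m, j < n) S i j w.

(* Main.v *)
Require Import Defs.
From HB Require Import structures.
From mathcomp Require Import all_boot all_order all_algebra.
From mathcomp Require Import all_classical all_reals all_analysis.
From mathcomp Require Import measurable_realfun ring lra.

Set Implicit Arguments.
Unset Strict Implicit.
Unset Printing Implicit Defensive.

Import Order.TTheory GRing.Theory Num.Theory.
Import numFieldNormedType.Exports.

Local Open Scope classical_set_scope.
Local Open Scope ring_scope.

(** Let r = b - A x*, so that A^T r = 0, and W = (S A)^T (S A).  Pythagoras' theorem gives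
    the first equality.  The normal equations of the sketched problem give
    A (xhat - x* ) = L_0 S^T S r where L_0 = A W^-1 A^T, whenever W is invertible, so what has
    to be computed is E |L_0 S^T S r|^2.

    For e > 0 let L_e = A (W + e A^T A)^-1 A^T be the ridge-regularised operator.  It exists
    for every S, and L_e, S L_e and S L_e S^T are bounded, uniformly in S, because of the
    identity L_e = (S L_e)^T (S L_e) + e L_e^2.  Stein's identity
    E[S_ij F(S)] = E[d_ij F(S)] / m ([sketch_stein]) holds for each entry: that entry is
    independent of the sigma-algebra of the others, so Fubini's theorem reduces it to an
    integration by parts against the normal density.  It is used twice.
    - For F_ij = (S L_e)_ij, summing over i and j, with t = tr L_e and q = tr (L_e^2):
      m (d - e E t) = (m - d - 1) E t + e E q + e E t^2 ([stein_trace]).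
    - For F_ij = r_j (S L_e^2 S^T S r)_i: since L_e r = 0, the derivatives of L_e in the
      direction of r vanish and only that of the last factor S r survives, whence
      E |L_e S^T S r|^2 = |r|^2 E (t - e q) / m ([stein_residual]).

    It remains to let e tend to 0.  By the first identity E t is bounded uniformly in e; since
    t is at least of order 1/e where W is singular, W is almost surely invertible
    ([ridge_gram_ae_unit]).  By Fatou's lemma tr L_0 is then integrable.  It dominates t,
    e q and e t^2 up to the factor d, so dominated convergence yields
    E tr L_0 = m d / (m - d - 1), the trace form of the mean of an inverse Wishart matrix
    ([trace_inverse_gram]).  The same scheme in the second identity gives
    E |L_0 S^T S r|^2 = |r|^2 d / (m - d - 1) ([expected_sqr_ridge_fit]). *)

(** * Stein's identity for a normal variable *)

Section gaussian_density.
Context {R : realType}.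
Variable s : R.
Let TR : measurableType _ := measurableTypeR R.
Local Notation mu := (@lebesgue_measure R).
Local Notation N := (normal_prob 0 s).
Local Notation phi := (normal_pdf 0 s).
Local Open Scope ereal_scope.

(** The density is a Radon-Nikodym derivative of the normal law, so the two agree almost
    everywhere and the change of variables for the latter applies. *)
Lemma ge0_integral_normal_prob (f : TR -> \bar R) :
  measurable_fun setT f -> (forall x, 0 <= f x) ->
  \int[N]_x f x = \int[mu]_x (f x * (phi x)%:E).
Proof.
move=> mf f0.
have dom : N `<< mu by exact: normal_prob_dominates.
rewrite -(Radon_Nikodym_SigmaFinite.change_of_variables dom)//=.
apply: ae_eq_integral => //.
- apply: emeasurable_funM => //; apply: (measurable_int mu).
  exact: Radon_Nikodym_SigmaFinite.f_integrable.
- apply: emeasurable_funM => //; apply/measurable_EFinP.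
  exact: measurable_normal_pdf.
- apply: ae_eqe_mul2l => /=.
  apply: integral_ae_eq => //.
  + exact: Radon_Nikodym_SigmaFinite.f_integrable.
  + by apply/measurable_EFinP; exact: measurable_normal_pdf.
  + by move=> E _ mE; rewrite -Radon_Nikodym_SigmaFinite.f_integral.
Qed.

Lemma integrable_normal_prob (f : TR -> \bar R) :
  measurable_fun setT f ->
  mu.-integrable setT (fun x => f x * (phi x)%:E) ->
  N.-integrable setT f.
Proof.
move=> mf /integrableP[_ fi]; apply/integrableP; split => //.
rewrite ge0_integral_normal_prob//; last exact: measurableT_comp.
move: fi; congr (_ < _); apply: eq_integral => x _.
by rewrite abseM [X in _ * X]gee0_abs// lee_fin normal_pdf_ge0.
Qed.

Lemma integral_normal_prob (f : TR -> \bar R) :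
  measurable_fun setT f ->
  mu.-integrable setT (fun x => f x * (phi x)%:E) ->
  \int[N]_x f x = \int[mu]_x (f x * (phi x)%:E).
Proof.
move=> mf fi; rewrite [LHS]integralE [RHS]integralE.
have phi0 x : 0 <= (phi x)%:E by rewrite lee_fin normal_pdf_ge0.
rewrite !ge0_integral_normal_prob//; last 2 first.
- exact: measurable_funeneg.
- exact: measurable_funepos.
congr (_ - _); apply: eq_integral => x _.
- by rewrite !funeposE maxe_pMl ?mul0e.
- by rewrite !funenegE -mulNe maxe_pMl ?mul0e.
Qed.

End gaussian_density.

Section gaussian_stein.
Context {R : realType}.
Variable s : R.
Hypothesis s0 : 0 < s.
Local Notation mu := (@lebesgue_measure R).
Local Notation N := (normal_prob 0 s).
Local Notation phi := (normal_pdf 0 s).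

Lemma is_derive_normal_pdf (x : R) :
  is_derive x 1 phi (- (x / s ^+ 2) * phi x).
Proof.
have sn0 : s != 0 by rewrite gt_eqF.
rewrite normal_pdfE//.
have D : is_derive x (1 : R) (fun y : R => - (y - 0) ^+ 2 / (s ^+ 2 *+ 2)) (- (x / s ^+ 2)).
  apply: is_derive_eq.
  rewrite scaler0 !subr0 add0r -(mulr_natl (s ^+ 2)).
  rewrite /GRing.scale/=. field. done.
have := @is_derive1_comp R expR _ x _ _ (is_derive_expR _) D.
move=> E; have := is_deriveZ (normal_peak s) E.
rewrite /normal_fun/=.
move=> ?; apply: is_derive_eq.
by rewrite /GRing.scale/=; ring.
Qed.

(** A quadratic weight is absorbed by doubling the standard deviation: with
    u = 3 x^2 / (8 s^2) the ratio of the two exponentials is exp (- u) <= 1 / (1 + u). *)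
Lemma normal_pdf_moment (x : R) :
  (1 + `|x|) ^+ 2 * phi x <= (4 + 16 * s ^+ 2) * normal_pdf 0 (2 * s) x.
Proof.
have sn0 : s != 0 by rewrite gt_eqF.
have s20 : 2 * s != 0 by rewrite mulf_neq0// pnatr_eq0.
rewrite !normal_pdfE// /normal_fun subr0.
have -> : normal_peak (2 * s) = normal_peak s / 2.
  rewrite /normal_peak exprMn -mulrA -mulrnAr sqrtrM ?sqr_ge0//.
  by rewrite sqrtr_sqr ger0_norm// invfM mulrC.
rewrite mulrCA -mulrA [leRHS]mulrCA ler_wpM2l ?normal_peak_ge0//.
pose u := 3 * x ^+ 2 / (8 * s ^+ 2).
have -> : - x ^+ 2 / (s ^+ 2 *+ 2) = - u + - x ^+ 2 / ((2 * s) ^+ 2 *+ 2).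
  by rewrite /u -(mulr_natl (s ^+ 2)) -(mulr_natl ((2 * s) ^+ 2)); field.
rewrite expRD mulrA mulrA ler_wpM2r ?expR_ge0//.
have u0 : 0 <= u by rewrite /u divr_ge0// mulr_ge0// sqr_ge0.
have eu : expR (- u) <= (1 + u)^-1.
  rewrite expRN lef_pV2 ?posrE ?expR_gt0 ?expR_ge1Dx//.
  by rewrite ltr_pwDl.
have x2 : (1 + `|x|) ^+ 2 <= 2 + 2 * x ^+ 2.
  rewrite -(real_normK (num_real x)).
  have := sqr_ge0 (1 - `|x|); nra.
have -> : (4 + 16 * s ^+ 2) / 2 = 2 + 8 * s ^+ 2 by field.
apply: (le_trans (ler_pM (sqr_ge0 _) (expR_ge0 _) x2 eu)).
rewrite ler_pdivrMr ?ltr_pwDl//.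
have -> : x ^+ 2 = u * 8 * s ^+ 2 / 3 by rewrite /u; field.
have s2 := sqr_ge0 s.
have := mulr_ge0 u0 s2; nra.
Qed.


Lemma integrable_growth_pdf (f : R -> R) (C : R) : measurable_fun setT f ->
  (forall x, `|f x| <= C * (1 + `|x|) ^+ 2) ->
  mu.-integrable setT (fun x => (f x * phi x)%:E).
Proof.
move=> mf fC.
apply: (@le_integrable _ _ _ mu setT measurableT _
  (fun x => (C * (4 + 16 * s ^+ 2))%:E * (normal_pdf 0 (2 * s) x)%:E)%E).
- apply/measurable_EFinP; apply: measurable_funM => //.
  exact: measurable_normal_pdf.
- move=> x _; rewrite lee_fin.
  rewrite !normrM !(ger0_norm (normal_pdf_ge0 _ _ _)) -normrM.
  apply: le_trans (ler_wpM2r (normal_pdf_ge0 _ _ _) (ler_norm _)).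
  rewrite -mulrA; apply: (@le_trans _ _ (C * ((1 + `|x|) ^+ 2 * phi x))).
    by rewrite mulrA ler_wpM2r ?normal_pdf_ge0.
  rewrite ler_wpM2l ?normal_pdf_moment//.
  by have := le_trans (normr_ge0 _) (fC 0); rewrite normr0 addr0 expr1n mulr1.
- by apply: integrableZl => //; exact: integrable_normal_pdf.
Qed.

Lemma integrable_growth_normal (f : R -> R) (C : R) : measurable_fun setT f ->
  (forall x, `|f x| <= C * (1 + `|x|) ^+ 2) ->
  N.-integrable setT (fun x => (f x)%:E).
Proof.
move=> mf fC; apply: integrable_normal_prob; first exact/measurable_EFinP.
exact: integrable_growth_pdf mf fC.
Qed.

Lemma integral_growth_normal (f : R -> R) (C : R) : measurable_fun setT f ->
  (forall x, `|f x| <= C * (1 + `|x|) ^+ 2) ->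
  (\int[N]_x (f x)%:E = \int[mu]_x (f x * phi x)%:E)%E.
Proof.
move=> mf fC; rewrite integral_normal_prob//; first exact/measurable_EFinP.
exact: integrable_growth_pdf mf fC.
Qed.

Let F (h : R -> R) x := h x * phi x.

(** The boundary terms of the integration by parts vanish at both ends: the sequence u runs
    through the integers or their opposites. *)
Lemma cvg_growth_pdf (h : R -> R) (C : R) : (forall x, `|h x| <= C * (1 + `|x|)) ->
  (forall u : R^nat, (forall n, `|u n| = n%:R) -> F h (u n) @[n --> \oo] --> (0:R)).
Proof.
move=> hC u un.
pose K := C * (4 + 16 * s ^+ 2) * normal_peak (2 * s).
apply/norm_cvg0P.
apply: (@squeeze_cvgr _ _ _ _ (cst 0) (fun n => K * n.+1%:R^-1)).
- near=> n; rewrite normr_ge0/= /F normrM (ger0_norm (normal_pdf_ge0 _ _ _)).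
  have C0 : 0 <= C.
    by have := le_trans (normr_ge0 _) (hC 0); rewrite normr0 addr0 mulr1.
  rewrite ler_pdivlMr// -natr1 (addrC n%:R) -(un n).
  apply: (@le_trans _ _ (C * ((1 + `|u n|) ^+ 2 * phi (u n)))).
    rewrite expr2 (_ : C * _ = C * (1 + `|u n|) * phi (u n) * (1 + `|u n|)); last by ring.
    by rewrite ler_wpM2r ?addr_ge0// ler_wpM2r ?normal_pdf_ge0.
  rewrite /K -[leRHS]mulrA ler_wpM2l//.
  apply: (le_trans (normal_pdf_moment _)).
  rewrite mulrA ler_wpM2l//; first by have := sqr_ge0 s; lra.
  by rewrite normal_pdf_ub// mulf_neq0// ?pnatr_eq0// gt_eqF.
- exact: cvg_cst.
- rewrite -[X in _ --> X](mulr0 K); apply: cvgM; first exact: cvg_cst.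
  exact: cvg_harmonic.
Unshelve. all: by end_near. Qed.

(** (h phi)' = h' phi - x h phi / s^2 has integral 0, as the limit of its integrals over
    the segments [-n, n]. *)
Lemma normal_stein (h h' : R -> R) (C : R) :
  (forall x : R, is_derive x (1 : R) h (h' x)) -> continuous h' ->
  (forall x, `|h x| <= C * (1 + `|x|)) ->
  (forall x, `|h' x| <= C * (1 + `|x|)) ->
  (\int[N]_x (x * h x)%:E = (s ^+ 2)%:E * \int[N]_x (h' x)%:E)%E.
Proof.
move=> dh ch' hC h'C.
have sn0 : s != 0 by rewrite gt_eqF.
have C0 : 0 <= C.
  by have := le_trans (normr_ge0 _) (hC 0); rewrite normr0 addr0 mulr1.
have ch : continuous h.
  by move=> x; apply/differentiable_continuous/derivable1_diffP; case: (dh x).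
have mh : measurable_fun setT h by exact: continuous_measurable_fun.
have mh' : measurable_fun setT h' by exact: continuous_measurable_fun.
have x1 (x : R) : 1 <= 1 + `|x| by rewrite lerDl.
have xhC x : `|x * h x| <= C * (1 + `|x|) ^+ 2.
  rewrite normrM expr2 mulrCA; apply: ler_pM => //.
  by rewrite lerDr.
have h'C2 x : `|h' x| <= C * (1 + `|x|) ^+ 2.
  apply: (le_trans (h'C x)); rewrite ler_wpM2l// expr2.
  by rewrite ler_peMl// (le_trans ler01).
have mxh : measurable_fun [set: R] (fun x : R => x * h x).
  exact: measurable_funM.
rewrite (integral_growth_normal mxh xhC) (integral_growth_normal mh' h'C2).
pose f x := h' x * phi x - x / s ^+ 2 * h x * phi x.
have dF (x : R) : is_derive x (1 : R) (F h) (f x).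
  have := is_deriveM (dh x) (is_derive_normal_pdf x).
  move=> ?; apply: is_derive_eq.
  by rewrite /f /GRing.scale/=; ring.
have cf : continuous f.
  move=> x; apply: cvgB; apply: cvgM; try exact: ch'; try exact: continuous_normal_pdf.
  apply: cvgM; last exact: ch.
  by apply: cvgM; [exact: cvg_id|exact: cvg_cst].
have i1 := integrable_growth_pdf mh' h'C2.
have i2 := integrable_growth_pdf mxh xhC.
have i3 : mu.-integrable setT (fun x => (s ^+ 2)^-1%:E * (x * h x * phi x)%:E)%E.
  exact: integrableZl.
have fE x : (f x)%:E = ((h' x * phi x)%:E - (s ^+ 2)^-1%:E * (x * h x * phi x)%:E)%E.
  by rewrite -EFinM -EFinB; congr EFin; rewrite /f; ring.
have fi : mu.-integrable setT (fun x => (f x)%:E).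
  under eq_fun do rewrite fE.
  exact: integrableB.
have f0 : (\int[mu]_x (f x)%:E = 0)%E.
  pose fn n x := ((f \_ `[- n%:R, n%:R]) x)%:E.
  have cvg1 : (\int[mu]_x fn n x @[n --> \oo] --> \int[mu]_x (f x)%:E)%E.
    have [|||||_ _ cv] := @dominated_convergence _ _ _ mu setT measurableT fn (fun x => (f x)%:E) (fun x => `|(f x)%:E|%E); last exact: cv.
    - move=> n; apply/measurable_EFinP.
      apply/(measurable_restrictT _ _).1 => //.
      by apply/measurable_funTS; exact: continuous_measurable_fun.
    - by apply/measurable_EFinP; exact: continuous_measurable_fun.
    - apply: aeW => x _; apply: cvg_near_cst.
      near=> n; rewrite /fn patchE mem_set//= in_itv/= -ler_norml.
      near: n; exact: nbhs_infty_ger.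
    - exact: integrable_abse.
    - apply: aeW => x n _; rewrite /fn patchE; case: ifPn => // _.
      by rewrite abse0.
  have cvg2 : (\int[mu]_x fn n x @[n --> \oo] --> 0)%E.
    have -> : (fun n => \int[mu]_x fn n x)%E = (fun n => (F h n%:R - F h (- n%:R))%:E).
      apply/funext => n.
      transitivity (\int[mu]_(x in `[(- n%:R)%R, n%:R%R]) (f x)%:E)%E.
        rewrite [RHS]integral_mkcond; apply: eq_integral => x _.
        by rewrite /fn !patchE; case: ifP.
      have [->|n0] := eqVneq n 0.
        by rewrite oppr0 subrr set_itv1 integral_set1.
      rewrite (@continuous_FTC2 _ f (F h)) ?EFinB//.
      + by rewrite gtrN// ltr0n lt0n.
      + exact: continuous_subspaceT.
      + have dFc y : {for y, continuous (F h)}.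
          by apply/differentiable_continuous/derivable1_diffP; case: (dF y).
        split.
        * by move=> y _; case: (dF y).
        * by apply: cvg_at_right_filter; exact: dFc.
        * by apply: cvg_at_left_filter; exact: dFc.
      + by move=> y _; rewrite derive1E; case: (dF y).
    apply: cvg_EFin; first by near=> n.
    rewrite -(subrr (0:R)); apply: cvgB.
    - by apply: cvg_growth_pdf hC _ _ => n; rewrite ger0_norm.
    - by apply: cvg_growth_pdf hC _ _ => n; rewrite normrN ger0_norm.
  exact: cvg_unique cvg1 cvg2.
move: f0; under eq_integral do rewrite fE.
rewrite integralB//= integralZl//.
have := integrable_fin_num measurableT i1; have := integrable_fin_num measurableT i2.
move=> /fineK <- /fineK <-; rewrite -!EFinM -EFinB => -[] /eqP.
rewrite subr_eq0 => /eqP ->; congr EFin.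
by rewrite mulrA divff ?mul1r// expf_neq0.
Unshelve. all: by end_near. Qed.

End gaussian_stein.

(** * Integration against an independent variable *)

Section independent_fubini.
Context (disp : measure_display) (T : measurableType disp) (R : realType)
  (P : probability T R).
Variable G : set (set T).
Hypothesis Gm : G `<=` measurable.
Hypothesis GI : setI_closed G.
Hypothesis GT : G setT.
Variable X : {RV P >-> R}.
Hypothesis XG : forall (A : set R) (B : set T), measurable A -> G B ->
  P (X @^-1` A `&` B) = (P (X @^-1` A) * P B)%E.

Let T' := g_sigma_algebraType G.

(** The identity, seen as a map onto the same space with the coarser sigma-algebra generated
    by G: its law is the restriction of P to that sigma-algebra. *)
Definition coarsen (w : T) : T' := w.

Lemma coarsen_measurable : measurable_fun setT coarsen.
Proof.
move=> _ A mA; rewrite setTI /coarsen.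
by move: A mA; apply: smallest_sub; first exact: sigma_algebra_measurable.
Qed.

HB.instance Definition _ :=
  isMeasurableFun.Build _ _ _ _ coarsen coarsen_measurable.

Definition with_coarsen (w : T) : R * T' := (X w, w).

Lemma with_coarsen_measurable : measurable_fun setT with_coarsen.
Proof. by apply: measurable_fun_pair => //; exact: coarsen_measurable. Qed.

HB.instance Definition _ :=
  isMeasurableFun.Build _ _ _ _ with_coarsen with_coarsen_measurable.

Local Notation Q := (distribution P coarsen).

(** Both sides are finite measures in B which agree on the pi-system G. *)
Lemma with_coarsen_prod (A : set R) (B : set T') :
  measurable A -> measurable B ->
  distribution P with_coarsen (A `*` B) = (distribution P X A * Q B)%E.
Proof.
move=> mA mB.
have mXA : measurable (X @^-1` A) by rewrite -[_ @^-1` _]setTI; exact: measurable_funP.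
pose m1 := measure_function_pushforward__canonical__measure_function_Measure (mrestr P mXA) coarsen_measurable.
have Afin : P (X @^-1` A) \is a fin_num by exact: fin_num_measure.
have r0 : (0 <= fine (P (X @^-1` A)))%R by exact: fine_ge0.
pose m2 : {measure set T' -> \bar R} := mscale (NngNum r0) Q.
have m12 : m1 B = m2 B.
  apply: (@measure_unique _ R T' G (fun=> setT)) => //.
  - by apply/seteqP; split => // w _; exists 0%N.
  - move=> C GC; rewrite /m1 /m2 /= /mscale/= fineK// /distribution /pushforward /mrestr.
    by rewrite setIC; exact: XG.
  - move=> _; rewrite /m1/= /pushforward /mrestr preimage_setT setTI.
    exact: (le_lt_trans (probability_le1 _ mXA) (ltry _)).
transitivity (m1 B).
  rewrite /m1/= /distribution /pushforward /mrestr; congr (P _).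
  by rewrite setIC; apply/seteqP; split => w.
by rewrite m12 /m2/= /mscale/= fineK.
Qed.

(** A variable independent of the sigma-algebra generated by G can be integrated first: the
    joint law of the variable and of the coarsened sample point is a product measure. *)
Lemma integral_independent (f : R * T' -> R) :
  measurable_fun setT f ->
  P.-integrable setT (fun w => (f (X w, w))%:E) ->
  (\int[P]_w (f (X w, w))%:E =
   \int[Q]_w \int[distribution P X]_x (f (x, w))%:E)%E.
Proof.
move=> mf fi.
pose g z := (f z)%:E.
have mg : measurable_fun setT g by exact/measurable_EFinP.
have gi : (distribution P with_coarsen).-integrable setT g.
  by apply: integrable_pushforward => //; exact: with_coarsen_measurable.
have E : forall U : set (R * T'), measurable U ->
    (distribution P X \x Q)%E U = distribution P with_coarsen U.
  by apply: product_measure_unique => A B mA mB; exact: with_coarsen_prod.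
transitivity (\int[distribution P with_coarsen]_z g z)%E.
  rewrite integral_pushforward//; exact: with_coarsen_measurable.
have gi2 : (distribution P X \x Q)%E.-integrable setT g.
  apply/integrableP; split => //.
  rewrite (@eq_measure_integral _ _ _ _ (distribution P with_coarsen)).
    by move/integrableP : gi => [].
  by move=> U mU _; exact: E.
transitivity (\int[(distribution P X \x Q)%E]_z g z)%E.
  by apply: eq_measure_integral => U mU _; exact/esym/E.
by rewrite -integral21_prod_meas1.
Qed.

End independent_fubini.

(** * Stein's identity for a Gaussian sketch *)

Section sketch_stein.
Context (disp : measure_display) (T : measurableType disp) (R : realType)
  (P : probability T R) (m n : nat).
Variable S : 'I_m -> 'I_n -> {RV P >-> R}.
Hypothesis hS : gaussian_sketch S.
Hypothesis m0 : (0 < m)%N.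

Definition l1norm (p q : nat) (s : 'M[R]_(p, q)) : R := \sum_i \sum_j `|s i j|.

(** Measurability of a function of matrices, tested along matrices with measurable entries;
    the test space is arbitrary so that it may be a product on which one entry varies freely. *)
Definition measurable_functional (p q : nat) (Phi : 'M[R]_(p, q) -> R) :=
  forall (d : measure_display) (U : measurableType d) (s : U -> 'M[R]_(p, q)),
    (forall k l, measurable_fun setT (fun u => s u k l)) ->
    measurable_fun setT (fun u => Phi (s u)).

Let sg : R := Num.sqrt m%:R^-1.

Let sg_gt0 : 0 < sg. Proof. by rewrite sqrtr_gt0 invr_gt0 ltr0n. Qed.

Let sg2 : sg ^+ 2 = m%:R^-1. Proof. by rewrite sqr_sqrtr// invr_ge0. Qed.

Lemma l1norm_ge0 p q (s : 'M[R]_(p, q)) : 0 <= l1norm s.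
Proof. by apply: sumr_ge0 => i _; apply: sumr_ge0. Qed.

Lemma entry_le_l1norm p q (s : 'M[R]_(p, q)) i j : `|s i j| <= l1norm s.
Proof.
rewrite /l1norm (bigD1 i)//= (bigD1 j)//= -addrA lerDl addr_ge0 ?sumr_ge0//.
by move=> k _; exact: sumr_ge0.
Qed.

Lemma sqr_l1norm_le p q (s : 'M[R]_(p, q)) :
  l1norm s ^+ 2 <= (p * q)%:R * \sum_i \sum_j s i j ^+ 2.
Proof.
rewrite /l1norm !pair_bigA/= expr2 big_distrlr/=.
apply: (@le_trans _ _ (\sum_(u : 'I_p * 'I_q) \sum_(v : 'I_p * 'I_q)
   (s u.1 u.2 ^+ 2 / 2 + s v.1 v.2 ^+ 2 / 2))).
  apply: ler_sum => u _; apply: ler_sum => v _.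
  rewrite -[s u.1 u.2 ^+ 2]real_normK ?num_real// -[s v.1 v.2 ^+ 2]real_normK ?num_real//.
  have := sqr_ge0 (`|s u.1 u.2| - `|s v.1 v.2|); lra.
pose a (u : 'I_p * 'I_q) := s u.1 u.2 ^+ 2 / 2.
rewrite (eq_bigr (fun u => a u *+ (p * q) + \sum_v a v)); last first.
  by move=> u _; rewrite big_split/= sumr_const card_prod !card_ord.
rewrite big_split/= sumrMnl sumr_const card_prod !card_ord -mulrnDl.
rewrite -[leLHS]mulr_natl ler_wpM2l// -big_split/=; apply: ler_sum => u _.
by rewrite -splitr.
Qed.

(** Random variables take values in R with its generic measurable structure, normal_prob is a
    measure on measurableTypeR R.  The measurable sets are the same but the displays differ,
    so the two laws can only be compared after this change of codomain. *)
Lemma measurable_entry k l :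
  measurable_fun setT (S k l : T -> measurableTypeR R).
Proof. by move=> _ A mA; exact: (measurable_funP (S k l)). Qed.

Lemma ge0_integral_entry k l (f : R -> \bar R) : measurable_fun setT f ->
  (forall x, 0 <= f x)%E ->
  (\int[distribution P (S k l)]_x f x = \int[normal_prob 0 sg]_x f x)%E.
Proof.
move=> mf f0; rewrite ge0_integral_distribution//.
rewrite -(@ge0_integral_pushforward _ _ T (measurableTypeR R) R _ (measurable_entry k l) P setT f)//.
apply: eq_measure_integral; first exact: measurable_entry.
by move=> mS A mA _; exact: hS.1.
Qed.

Lemma integral_entry k l (f : R -> \bar R) : measurable_fun setT f ->
  (\int[distribution P (S k l)]_x f x = \int[normal_prob 0 sg]_x f x)%E.
Proof.
move=> mf; rewrite [LHS]integralE [RHS]integralE !ge0_integral_entry//.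
- exact: measurable_funeneg.
- exact: measurable_funepos.
Qed.

Lemma integrable_sqr_entry k l : P.-integrable setT (fun w => (S k l w ^+ 2)%:E).
Proof.
have mf : measurable_fun [set: R] (fun x : R => (x ^+ 2)%:E).
  by apply/measurable_EFinP; exact: measurable_funX.
have /integrableP[_ fin] : (normal_prob 0 sg).-integrable setT (fun x => (x ^+ 2)%:E).
  apply: (@integrable_growth_normal _ _ sg_gt0 _ 1); first exact: measurable_funX.
  move=> x; rewrite mul1r normrX lerXn2r ?nnegrE ?addr_ge0//.
  by rewrite lerDr.
apply/integrableP; split.
  by apply/measurable_EFinP; apply: measurable_funX.
have := @ge0_integral_distribution _ _ _ _ _ P (S k l) (fun x => `|(x ^+ 2)%:E|%E) _ _.
move=> <- //; last exact: measurableT_comp.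
rewrite integral_entry//; exact: measurableT_comp.
Qed.

Lemma measurable_functional_sketch (Phi : 'M[R]_(m, n) -> R) :
  measurable_functional Phi -> measurable_fun setT (fun w => Phi (sketch_mx S w)).
Proof.
apply => k l; rewrite (_ : (fun u => _) = S k l)//.
by apply/funext => w; rewrite mxE.
Qed.

Lemma integrable_quadratic_growth (Phi : 'M[R]_(m, n) -> R) (C : R) :
  measurable_functional Phi ->
  (forall s, `|Phi s| <= C * (1 + l1norm s) ^+ 2) ->
  P.-integrable setT (fun w => (Phi (sketch_mx S w))%:E).
Proof.
move=> mPhi PhiC.
have C0 : 0 <= C.
  have := le_trans (normr_ge0 _) (PhiC 0); rewrite pmulr_lge0// exprn_gt0//.
  by rewrite ltr_pwDl// l1norm_ge0.
pose f w : \bar R := ((C * 2)%:E * (1%:E + (m * n)%:R%:E * \sum_i \sum_j (S i j w ^+ 2)%:E))%E.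
apply: (@le_integrable _ _ _ P setT measurableT _ f).
- by apply/measurable_EFinP; exact: measurable_functional_sketch.
- move=> w _; rewrite /f.
  under eq_bigr do rewrite sumEFin.
  rewrite sumEFin -EFinM. rewrite /= lee_fin.
  apply: le_trans (ler_norm _); apply: (le_trans (PhiC _)).
  rewrite -mulrA ler_wpM2l//.
  have := sqr_l1norm_le (sketch_mx S w).
  have -> : \sum_i \sum_j sketch_mx S w i j ^+ 2 = \sum_i \sum_j S i j w ^+ 2.
    by apply: eq_bigr => i _; apply: eq_bigr => j _; rewrite mxE.
  have := sqr_ge0 (1 - l1norm (sketch_mx S w)); lra.
- apply: integrableZl => //; apply: integrableD => //.
    exact: finite_measure_integrable_cst.
  apply: integrableZl => //; apply: integrable_sum => // i _.
  by apply: integrable_sum => // j _; exact: integrable_sqr_entry.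
Qed.


Section one_entry.
Variables (i : 'I_m) (j : 'I_n).

Definition set_entry (s : 'M[R]_(m, n)) (x : R) : 'M[R]_(m, n) :=
  s + (x - s i j) *: delta_mx i j.

Lemma set_entryE s x k l :
  set_entry s x k l = if (k == i) && (l == j) then x else s k l.
Proof.
rewrite !mxE; case: ifPn => [/andP[/eqP-> /eqP->]|_]; last by rewrite mulr0 addr0.
by rewrite mulr1 subrKC.
Qed.

Lemma set_entry_id s : set_entry s (s i j) = s.
Proof. by rewrite /set_entry subrr scale0r addr0. Qed.

Lemma set_entryD s x y : set_entry s x + y *: delta_mx i j = set_entry s (x + y).
Proof. by rewrite /set_entry -addrA -scalerDl addrAC. Qed.

Lemma l1norm_set_entry s x : l1norm (set_entry s x) <= l1norm s + `|x|.
Proof.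
rewrite /l1norm !pair_bigA/= (bigD1 (i, j))//= set_entryE !eqxx/= addrC lerD2r.
rewrite [leRHS](bigD1 (i, j))//= ler_wpDl//; apply: ler_sum => -[k l] /= /negP kl.
by rewrite set_entryE; case: ifPn => // /andP[/eqP ki /eqP lj]; case: kl; rewrite ki lj.
Qed.

(* the pi-system of cylinders over the entries other than (i, j) *)
Let G : set (set T) := [set A | exists2 B : 'I_m * 'I_n -> set R,
  (forall kl, measurable (B kl)) &
  A = \bigcap_(kl in [set` [set~ (i, j)]%SET]) (S kl.1 kl.2 @^-1` B kl)].

Let mS k l (B : set R) : measurable B -> measurable (S k l @^-1` B).
Proof. by move=> mB; rewrite -[_ @^-1` _]setTI; exact: measurable_funP. Qed.

Let Gm : G `<=` measurable.
Proof.
move=> _ [B mB ->]; apply: fin_bigcap_measurable; first exact: finite_finset.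
by move=> kl _; exact: mS.
Qed.

Let GI : setI_closed G.
Proof.
move=> _ _ [B mB ->] [C mC ->]; exists (fun kl => B kl `&` C kl).
  by move=> kl; exact: measurableI.
by rewrite -bigcapI.
Qed.

Let GT : G setT.
Proof.
by exists (fun=> setT) => //; apply/esym/seteqP; split => // w _ kl _.
Qed.

Let indep (A : set R) (B : set T) : measurable A -> G B ->
  P (S i j @^-1` A `&` B) = (P (S i j @^-1` A) * P B)%E.
Proof.
move=> mA [C mC ->].
have [_ ind] := hS.
pose D kl := if kl == (i, j) then A else C kl.
have mD kl : measurable (D kl) by rewrite /D; case: ifP.
have := ind [set: 'I_m * 'I_n]%SET D (fun kl _ => mD kl).
have := ind [set~ (i, j)]%SET D (fun kl _ => mD kl).
have E : \bigcap_(kl in [set` [set~ (i, j)]%SET]) (S kl.1 kl.2 @^-1` D kl) =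
         \bigcap_(kl in [set` [set~ (i, j)]%SET]) (S kl.1 kl.2 @^-1` C kl).
  apply: eq_bigcapr => kl /=; rewrite !inE => /negbTE kl0.
  by rewrite /D kl0.
have E2 : \bigcap_(kl in [set` [set: 'I_m * 'I_n]%SET]) (S kl.1 kl.2 @^-1` D kl) =
    S i j @^-1` A `&` \bigcap_(kl in [set` [set~ (i, j)]%SET]) (S kl.1 kl.2 @^-1` C kl).
  rewrite -E; apply/seteqP; split => [w H|w [H1 H2] kl _].
    split; first by have := H (i, j); rewrite /D eqxx/=; apply; rewrite inE.
    by move=> kl _; apply: H; rewrite /= inE.
  have [->|kl0] := eqVneq kl (i, j); first by rewrite /D eqxx.
  by apply: H2; rewrite /= !inE.
rewrite E E2 => -> ->.
rewrite (bigD1 (i, j))/=; last by rewrite inE.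
rewrite {1}/D eqxx; congr (_ * _)%E.
by apply: eq_bigl => kl; rewrite !inE.
Qed.

(** With the other entries frozen, the function of the remaining entry satisfies the
    hypotheses of Stein's identity on the line; the growth constant then depends on the
    frozen entries, but linear growth in the whole matrix makes both sides integrable. *)
Lemma sketch_stein (Phi Phi' : 'M[R]_(m, n) -> R) (C : R) :
  measurable_functional Phi -> measurable_functional Phi' ->
  (forall s, is_derive (0 : R) (1 : R) (fun x : R => Phi (s + x *: delta_mx i j)) (Phi' s)) ->
  (forall s, continuous_at (0 : R) (fun x : R => Phi' (s + x *: delta_mx i j))) ->
  (forall s, `|Phi s| <= C * (1 + l1norm s)) ->
  (forall s, `|Phi' s| <= C * (1 + l1norm s)) ->
  (\int[P]_w (S i j w * Phi (sketch_mx S w))%:E =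
   m%:R^-1%:E * \int[P]_w (Phi' (sketch_mx S w))%:E)%E.
Proof.
move=> mPhi mPhi' dPhi cPhi' PhiC Phi'C.
have C0 : 0 <= C.
  have := le_trans (normr_ge0 _) (PhiC 0); rewrite pmulr_lge0//.
  by rewrite ltr_pwDl// l1norm_ge0.
pose T' := g_sigma_algebraType G.
have mS' k l : (k, l) != (i, j) -> measurable_fun setT (S k l : T' -> R).
  move=> kl _ B mB; rewrite setTI; apply: sub_sigma_algebra.
  exists (fun kl' => if kl' == (k, l) then B else setT) => [kl'|]; first by case: ifP.
  apply/seteqP; split => [w Bw kl' _|w].
    by rewrite /=; case: ifP => // /eqP ->.
  by move=> /(_ (k, l)) /=; rewrite eqxx !inE; apply.
have mset : forall k l, measurable_fun [set: R * T']
    (fun z : R * T' => set_entry (sketch_mx S z.2) z.1 k l).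
  move=> k l; have [kl|kl] := boolP ((k == i) && (l == j)).
    under eq_fun do rewrite set_entryE kl.
    exact: measurable_fst.
  under eq_fun do rewrite set_entryE (negbTE kl) mxE.
  apply: (measurableT_comp (f := S k l : T' -> R)); last exact: measurable_snd.
  by apply: mS'; rewrite xpair_eqE.
pose f (z : R * T') : R := z.1 * Phi (set_entry (sketch_mx S z.2) z.1).
pose f' (z : R * T') : R := Phi' (set_entry (sketch_mx S z.2) z.1).
have mf : measurable_fun setT f.
  by apply: measurable_funM; [exact: measurable_fst|exact: mPhi mset].
have mf' : measurable_fun setT f' by exact: mPhi' mset.
have fE w : f (S i j w, w) = S i j w * Phi (sketch_mx S w).
  by rewrite /f /= -{2}[S i j w]/((S i j) w) (_ : S i j w = sketch_mx S w i j) ?set_entry_id// mxE.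
have f'E w : f' (S i j w, w) = Phi' (sketch_mx S w).
  by rewrite /f' /= (_ : S i j w = sketch_mx S w i j) ?set_entry_id// mxE.
have l1 s : 1 <= 1 + l1norm s :> R by rewrite lerDl l1norm_ge0.
have fi : P.-integrable setT (fun w => (f (S i j w, w))%:E).
  under eq_fun do rewrite fE.
  pose Psi (s : 'M[R]_(m, n)) := s i j * Phi s.
  have Pe w : (S i j w * Phi (sketch_mx S w)) = Psi (sketch_mx S w).
    by rewrite /Psi mxE.
  under eq_fun do rewrite Pe.
  apply: (@integrable_quadratic_growth Psi C).
    by move=> d U s ms; apply: measurable_funM => //; exact: mPhi.
  move=> s; rewrite normrM expr2 mulrCA; apply: ler_pM => //.
  by rewrite (le_trans (entry_le_l1norm s i j))// lerDr.
have f'i : P.-integrable setT (fun w => (f' (S i j w, w))%:E).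
  under eq_fun do rewrite f'E.
  apply: (@integrable_quadratic_growth Phi' C) => // s.
  apply: (le_trans (Phi'C _)); rewrite ler_wpM2l// expr2.
  by rewrite ler_peMl// (le_trans ler01).
under eq_integral do rewrite -fE.
under [in RHS]eq_integral do rewrite -f'E.
pose c : R := m%:R^-1.
pose f2 z : R := c * f' z.
have mf2 : measurable_fun setT f2 by exact: measurable_funM.
have f2i : P.-integrable setT (fun w => (f2 (S i j w, w))%:E).
  by under eq_fun do rewrite /f2 EFinM; exact: integrableZl.
rewrite -integralZl//.
under [RHS]eq_integral do rewrite -EFinM -/(f2 (_, _)).
rewrite (integral_independent Gm GI GT indep mf fi).
rewrite (integral_independent Gm GI GT indep mf2 f2i).
apply: eq_integral => w _.
have me : measurable_fun [set: R] (fun x : R => (f (x, w))%:E).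
  apply/measurable_EFinP; exact: (measurableT_comp mf (pair2_measurable _)).
have me2 : measurable_fun [set: R] (fun x : R => (f2 (x, w))%:E).
  apply/measurable_EFinP; exact: (measurableT_comp mf2 (pair2_measurable _)).
have me' : measurable_fun [set: R] (fun x : R => f' (x, w)).
  exact: (measurableT_comp mf' (pair2_measurable _)).
rewrite !integral_entry//.
set s0 := sketch_mx S w.
have growth (Psi : 'M[R]_(m, n) -> R) : (forall s, `|Psi s| <= C * (1 + l1norm s)) ->
    forall x, `|Psi (set_entry s0 x)| <= C * (1 + l1norm s0) * (1 + `|x|).
  move=> PsiC x; apply: (le_trans (PsiC _)); rewrite -mulrA ler_wpM2l//.
  have := l1norm_set_entry s0 x; have := l1norm_ge0 s0.
  have := normr_ge0 x; nra.
have h'C := growth _ Phi'C.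
have -> : (\int[normal_prob 0 sg]_x (f2 (x, w))%:E =
           (sg ^+ 2)%:E * \int[normal_prob 0 sg]_x (f' (x, w))%:E)%E.
  rewrite -integralZl//; first by apply: eq_integral => x _; rewrite -EFinM sg2.
  apply: (@integrable_growth_normal _ _ sg_gt0 _ (C * (1 + l1norm s0))) => // x.
  apply: (le_trans (h'C x)); apply: ler_wpM2l.
    by rewrite mulr_ge0// addr_ge0// l1norm_ge0.
  by rewrite expr2 ler_peMl ?lerDl// addr_ge0.
apply: (@normal_stein _ sg sg_gt0 (fun x => Phi (set_entry s0 x))
  (fun x => f' (x, w)) (C * (1 + l1norm s0))).
- move=> x; have := dPhi (set_entry s0 x).
  under eq_fun do rewrite set_entryD.
  move=> D0; have D1 : is_derive x (1 : R) (fun y : R => y - x) 1.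
    by apply: is_derive_eq; rewrite subr0.
  rewrite -(subrr x) in D0.
  have := @is_derive1_comp R (fun y => Phi (set_entry s0 (x + y))) (fun y => y - x) x _ _ D0 D1.
  rewrite mulr1.
  by congr is_derive; apply/funext => y /=; rewrite subrKC.
- have cont x : continuous_at x (fun y : R => Phi' (set_entry s0 y)).
    have := cPhi' (set_entry s0 x).
    under eq_fun do rewrite set_entryD.
    move=> c0.
    have cs : {for x, continuous (fun y : R => y - x)}.
      by apply: cvgB; [exact: cvg_id|exact: cvg_cst].
    rewrite -(subrr x) in c0.
    have := continuous_comp cs c0.
    rewrite (_ : _ \o _ = fun y => Phi' (set_entry s0 y))//.
    by apply/funext => y /=; rewrite subrKC.
  by move=> x; exact: cont.
- exact: growth.
- exact: growth.
Qed.

End one_entry.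
End sketch_stein.

(** * Ridge-regularised solution operator *)

(** These specialise mxE to one layer: on an entry of a sum of ridge operators,
    mxE itself would unfold the operators into their defining products. *)
Section entries.
Context (R : realType) (p q : nat).
Implicit Types X Y : 'M[R]_(p, q).

Lemma entryD X Y i j : (X + Y) i j = X i j + Y i j.
Proof. by rewrite mxE. Qed.

Lemma entryN X i j : (- X) i j = - X i j.
Proof. by rewrite mxE. Qed.

Lemma entryB X Y i j : (X - Y) i j = X i j - Y i j.
Proof. by rewrite entryD entryN. Qed.

Lemma entryZ a X i j : (a *: X) i j = a * X i j.
Proof. by rewrite mxE. Qed.

End entries.

Section ridge.
Context (R : realType) (m n d : nat).
Variable A : 'M[R]_(n, d).
Hypothesis kerA : forall v : 'cV[R]_d, A *m v = 0 -> v = 0.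

Lemma sumsq_mulmx (k l : nat) (B : 'M[R]_(k, l)) j :
  (B^T *m B) j j = \sum_i B i j ^+ 2.
Proof. by rewrite mxE; apply: eq_bigr => i _; rewrite mxE expr2. Qed.

Lemma unitmx_ker0 (k : nat) (B : 'M[R]_k) :
  (forall v : 'cV[R]_k, B *m v = 0 -> v = 0) -> B \in unitmx.
Proof.
move=> B0; rewrite -unitmx_tr -row_free_unit -kermx_eq0.
apply/eqP/row_matrixP => i; rewrite row0; apply: trmx_inj; rewrite trmx0.
by apply: B0; rewrite -{1}[B]trmxK -trmx_mul -row_mul mulmx_ker row0 trmx0.
Qed.

Definition ridge_gram (e : R) (S : 'M[R]_(m, n)) : 'M[R]_d :=
  (S *m A)^T *m (S *m A) + e *: (A^T *m A).

(** A (ridge_gram)^-1 A^T, with the inverse written as adjugate over determinant so that the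
    operator is measurable as it stands, and is 0 when the matrix is singular. *)
Definition ridge (e : R) (S : 'M[R]_(m, n)) : 'M[R]_n :=
  A *m ((\det (ridge_gram e S))^-1 *: \adj (ridge_gram e S)) *m A^T.

Lemma ridgeE e S : ridge_gram e S \in unitmx ->
  ridge e S = A *m invmx (ridge_gram e S) *m A^T.
Proof. by move=> u; rewrite /ridge /invmx u. Qed.

Lemma ridge_gram_unit e S : 0 < e -> ridge_gram e S \in unitmx.
Proof.
move=> e0; apply: unitmx_ker0 => v gv; apply: kerA.
have : (v^T *m (ridge_gram e S *m v)) 0 0 = 0 by rewrite gv mulmx0 mxE.
rewrite /ridge_gram mulmxDl mulmxDr.
have -> : v^T *m ((S *m A)^T *m (S *m A) *m v) = (S *m A *m v)^T *m (S *m A *m v).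
  by rewrite [in RHS]trmx_mul !mulmxA.
have -> : v^T *m (e *: (A^T *m A) *m v) = e *: ((A *m v)^T *m (A *m v)).
  by rewrite trmx_mul -scalemxAl -scalemxAr !mulmxA.
rewrite mxE [X in _ + X]mxE !sumsq_mulmx => /eqP.
rewrite paddr_eq0 ?mulr_ge0 ?(ltW e0)// ?sumr_ge0// => [/andP[_]|i _|i _]; try exact: sqr_ge0.
rewrite mulf_eq0 gt_eqF//= psumr_eq0 => [/allP Av|i _]; last exact: sqr_ge0.
apply/matrixP => i j; rewrite !ord1 [RHS]mxE.
by have := Av i (mem_index_enum _); rewrite sqrf_eq0 => /eqP.
Qed.

Lemma ridge_gram_tr e S : (ridge_gram e S)^T = ridge_gram e S.
Proof. by rewrite /ridge_gram linearD linearZ/= !trmx_mul !trmxK. Qed.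

Lemma ridge_gramE e S : ridge_gram e S = A^T *m (S^T *m S + e%:M) *m A.
Proof.
by rewrite /ridge_gram mulmxDr mulmxDl trmx_mul !mulmxA scalar_mxC mul_scalar_mx -scalemxAl.
Qed.

Section unit_gram.
Variables (e : R) (S : 'M[R]_(m, n)).
Hypothesis u : ridge_gram e S \in unitmx.
Local Notation L := (ridge e S).

Lemma ridge_tr : L^T = L.
Proof.
by rewrite ridgeE// !trmx_mul trmxK trmx_inv ridge_gram_tr mulmxA.
Qed.

(** Insert M (W + e A^T A) M = M for the inverse M of W + e A^T A.  This identity is the
    source of all bounds on the operator and of its positivity. *)
Lemma ridge_resolvent : L *m S^T *m (S *m L) + e *: (L *m L) = L.
Proof.
have -> : L *m S^T *m (S *m L) + e *: (L *m L) = L *m (S^T *m S + e%:M) *m L.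
  by rewrite mulmxDr mulmxDl mul_mx_scalar -scalemxAl !mulmxA.
rewrite ridgeE//; set M := invmx _.
have -> : A *m M *m A^T *m (S^T *m S + e%:M) *m (A *m M *m A^T) =
  A *m (M *m (A^T *m (S^T *m S + e%:M) *m A) *m M) *m A^T by rewrite !mulmxA.
by rewrite -ridge_gramE mulVmx// mul1mx.
Qed.

Lemma mxtrace_sketch_ridge : \tr (S *m L *m S^T) = d%:R - e * \tr L.
Proof.
apply/eqP; rewrite eq_sym subr_eq; apply/eqP.
rewrite -mxtraceZ mxtrace_mulC -[in X in _ + X]/(L) mulmxA.
rewrite -[X in \tr _ + \tr X]mul_scalar_mx -linearD/= -mulmxDl.
rewrite {1}ridgeE// !mulmxA mxtrace_mulC !mulmxA -ridge_gramE.
by rewrite mulmxV// mxtrace1.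
Qed.

Lemma ridge_ortho (r : 'cV[R]_n) : A^T *m r = 0 -> L *m r = 0.
Proof. by move=> Ar; rewrite /ridge -mulmxA Ar mulmx0. Qed.

Lemma ridge_diag j : L j j = \sum_i (S *m L) i j ^+ 2 + e * \sum_k L k j ^+ 2.
Proof.
rewrite -[in LHS]ridge_resolvent mxE [X in _ + X]mxE -!sumsq_mulmx.
by rewrite trmx_mul ridge_tr.
Qed.

(** The diagonal of the hat matrix N = S L S^T, for which the resolvent identity reads
    N = N^2 + e (S L) (S L)^T. *)
Lemma hat_diag i : (S *m L *m S^T) i i =
  \sum_k (S *m L *m S^T) k i ^+ 2 + e * \sum_j (S *m L) i j ^+ 2.
Proof.
rewrite -[in LHS]ridge_resolvent mulmxDr mulmxDl mxE.
congr (_ + _).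
  rewrite -sumsq_mulmx; congr (fun_of_matrix _ i i).
  by rewrite 2!trmx_mul trmxK ridge_tr !mulmxA.
rewrite -scalemxAr -scalemxAl mxE; congr (_ * _).
transitivity (((S *m L)^T^T *m (S *m L)^T) i i).
  by rewrite trmxK trmx_mul ridge_tr !mulmxA.
by rewrite sumsq_mulmx; apply: eq_bigr => k _; rewrite mxE.
Qed.

End unit_gram.

Lemma ridge_diff e f S : ridge_gram e S \in unitmx -> ridge_gram f S \in unitmx ->
  ridge f S - ridge e S = (e - f) *: (ridge f S *m ridge e S).
Proof.
move=> ue uf; rewrite !ridgeE//.
set M := invmx (ridge_gram e S); set N := invmx (ridge_gram f S).
have -> : A *m N *m A^T *m (A *m M *m A^T) = A *m (N *m (A^T *m A) *m M) *m A^T.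
  by rewrite !mulmxA.
rewrite scalemxAl scalemxAr -mulmxBl -mulmxBr; congr (_ *m _ *m _).
rewrite scalemxAl scalemxAr.
have -> : (e - f) *: (A^T *m A) = ridge_gram e S - ridge_gram f S.
  by rewrite /ridge_gram scalerBl opprD addrACA subrr add0r.
by rewrite mulmxBr mulmxBl mulVmx// mul1mx -mulmxA mulmxV// mulmx1.
Qed.

Lemma ridge_diff_sketch e S S' : ridge_gram e S \in unitmx -> ridge_gram e S' \in unitmx ->
  ridge e S' - ridge e S = ridge e S' *m (S^T *m S - S'^T *m S') *m ridge e S.
Proof.
move=> ue uf; rewrite !ridgeE//.
set M := invmx (ridge_gram e S); set N := invmx (ridge_gram e S').
set D := (S^T *m S - S'^T *m S').
have -> : A *m N *m A^T *m D *m (A *m M *m A^T) = A *m (N *m (A^T *m D *m A) *m M) *m A^T.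
  by rewrite !mulmxA.
rewrite -mulmxBl -mulmxBr; congr (_ *m _ *m _).
have -> : A^T *m D *m A = ridge_gram e S - ridge_gram e S'.
  rewrite /ridge_gram opprD addrACA subrr addr0 /D mulmxBr mulmxBl.
  by rewrite !trmx_mul !mulmxA.
by rewrite mulmxBr mulmxBl mulVmx// mul1mx -mulmxA mulmxV// mulmx1.
Qed.

End ridge.

(** * Measurability, growth and derivatives of matrix functionals *)

Section matrix_functionals.
Context (R : realType) (m n : nat).
Local Notation dom := 'M[R]_(m, n).

Definition mx_measurable p q (F : dom -> 'M[R]_(p, q)) :=
  forall i j, measurable_functional (fun s => F s i j).

Definition mx_growth k p q (F : dom -> 'M[R]_(p, q)) :=
  exists2 C : R, 0 <= C & forall s i j, `|F s i j| <= C * (1 + l1norm s) ^+ k.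

Definition mx_derive (E : dom) p q (F F' : dom -> 'M[R]_(p, q)) :=
  forall s i j, is_derive (0 : R) (1 : R) (fun x : R => F (s + x *: E) i j) (F' s i j).

Definition mx_cont (E : dom) p q (F : dom -> 'M[R]_(p, q)) :=
  forall s i j, continuous_at (0 : R) (fun x : R => F (s + x *: E) i j).

Lemma mx_measurable_cst p q (B : 'M[R]_(p, q)) : mx_measurable (fun=> B).
Proof. by move=> i j d U s _; exact: measurable_cst. Qed.

Lemma mx_measurable_id : mx_measurable (fun s => s).
Proof. by move=> i j d U s; apply. Qed.

Lemma mx_measurable_tr p q (F : dom -> 'M[R]_(p, q)) :
  mx_measurable F -> mx_measurable (fun s => (F s)^T).
Proof. by move=> mF i j d U s ms; under eq_fun do rewrite mxE; exact: mF. Qed.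

Lemma mx_measurableD p q (F G : dom -> 'M[R]_(p, q)) :
  mx_measurable F -> mx_measurable G -> mx_measurable (fun s => F s + G s).
Proof.
move=> mF mG i j d U s ms; under eq_fun do rewrite mxE.
by apply: measurable_funD; [exact: mF|exact: mG].
Qed.

Lemma mx_measurableN p q (F : dom -> 'M[R]_(p, q)) :
  mx_measurable F -> mx_measurable (fun s => - F s).
Proof.
move=> mF i j d U s ms; under eq_fun do rewrite mxE.
by apply: measurable_funN; exact: mF.
Qed.

Lemma mx_measurableM p q l (F : dom -> 'M[R]_(p, q)) (G : dom -> 'M[R]_(q, l)) :
  mx_measurable F -> mx_measurable G -> mx_measurable (fun s => F s *m G s).
Proof.
move=> mF mG i j d U s ms; under eq_fun do rewrite mxE.
by apply: measurable_sum => k; apply: measurable_funM; [exact: mF|exact: mG].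
Qed.

Lemma measurable_functional_det p (F : dom -> 'M[R]_p) :
  mx_measurable F -> measurable_functional (fun s => \det (F s)).
Proof.
move=> mF d U s ms; rewrite /determinant; apply: measurable_sum => g.
by apply: measurable_funM => //; apply: measurable_prod => i _; exact: mF.
Qed.

Lemma mx_measurable_adj p (F : dom -> 'M[R]_p) :
  mx_measurable F -> mx_measurable (fun s => \adj (F s)).
Proof.
move=> mF i j d U s ms; under eq_fun do rewrite mxE /cofactor.
apply: measurable_funM => //.
apply: (measurable_functional_det (F := fun s => row' j (col' i (F s)))) => // a b e V t mt.
by under eq_fun do rewrite !mxE; exact: mF.
Qed.

(** x^-1 = x (x^2)^-1, also at 0, and the power function is measurable. *)
Lemma measurable_invr : measurable_fun [set: R] (fun x : R => x^-1).
Proof.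
have -> : (fun x : R => x^-1) = (fun x => x * (x ^+ 2) `^ (-1)).
  apply/funext => x; rewrite powR_inv1 ?sqr_ge0// expr2 invfM.
  by have [->|x0] := eqVneq x 0; rewrite ?mul0r ?invr0// mulVKf.
apply: measurable_funM => //.
apply: (measurableT_comp (f := @powR R ^~ (-1))); first exact: measurable_powR.
exact: measurable_funX.
Qed.

Lemma mx_measurable_ridge_gram d (A : 'M[R]_(n, d)) (e : R) :
  mx_measurable (fun s : dom => ridge_gram A e s).
Proof.
apply: mx_measurableD; last exact: mx_measurable_cst.
apply: mx_measurableM; first apply: mx_measurable_tr.
  by apply: mx_measurableM; [exact: mx_measurable_id|exact: mx_measurable_cst].
by apply: mx_measurableM; [exact: mx_measurable_id|exact: mx_measurable_cst].
Qed.

Lemma mx_measurable_ridge d (A : 'M[R]_(n, d)) (e : R) :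
  mx_measurable (fun s : dom => ridge A e s).
Proof.
have mg := mx_measurable_ridge_gram A e.
apply: mx_measurableM; last exact: mx_measurable_cst.
apply: mx_measurableM; first exact: mx_measurable_cst.
move=> i j dd U s ms; under eq_fun do rewrite mxE.
apply: measurable_funM; last exact: (mx_measurable_adj mg).
apply: (measurableT_comp (f := fun x : R => x^-1)); first exact: measurable_invr.
exact: (measurable_functional_det mg).
Qed.

Lemma mx_growth_cst p q (B : 'M[R]_(p, q)) : mx_growth 0 (fun=> B).
Proof.
exists (l1norm B); first exact: l1norm_ge0.
by move=> s i j; rewrite mulr1; exact: entry_le_l1norm.
Qed.

Lemma mx_growth_id : mx_growth 1 (fun s => s).
Proof.
exists 1 => // s i j; rewrite mul1r expr1.
by rewrite (le_trans (entry_le_l1norm s i j))// lerDr.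
Qed.

Lemma mx_growth_tr k p q (F : dom -> 'M[R]_(p, q)) :
  mx_growth k F -> mx_growth k (fun s => (F s)^T).
Proof. by move=> [C C0 FC]; exists C => // s i j; rewrite mxE. Qed.

Lemma mx_growthD k p q (F G : dom -> 'M[R]_(p, q)) :
  mx_growth k F -> mx_growth k G -> mx_growth k (fun s => F s + G s).
Proof.
move=> [C C0 FC] [D D0 GD]; exists (C + D); first exact: addr_ge0.
move=> s i j; rewrite mxE (le_trans (ler_normD _ _))// mulrDl.
by rewrite lerD.
Qed.

Lemma mx_growthN k p q (F : dom -> 'M[R]_(p, q)) :
  mx_growth k F -> mx_growth k (fun s => - F s).
Proof. by move=> [C C0 FC]; exists C => // s i j; rewrite mxE normrN. Qed.

Lemma mx_growthM k k' p q l (F : dom -> 'M[R]_(p, q)) (G : dom -> 'M[R]_(q, l)) :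
  mx_growth k F -> mx_growth k' G -> mx_growth (k + k') (fun s => F s *m G s).
Proof.
move=> [C C0 FC] [D D0 GD]; exists (q%:R * (C * D)); first by rewrite !mulr_ge0.
move=> s i j; rewrite mxE (le_trans (ler_norm_sum _ _ _))//.
apply: (@le_trans _ _ (\sum_(u < q) (C * D) * (1 + l1norm s) ^+ (k + k'))).
  apply: ler_sum => u _; rewrite normrM exprD mulrACA.
  by apply: ler_pM.
by rewrite sumr_const card_ord -[leLHS]mulr_natl !mulrA.
Qed.

Variable E : dom.

Lemma mx_derive_cont p q (F F' : dom -> 'M[R]_(p, q)) :
  mx_derive E F F' -> mx_cont E F.
Proof.
move=> dF s i j; apply/differentiable_continuous/derivable1_diffP.
by case: (dF s i j).
Qed.

Lemma mx_derive_cst p q (B : 'M[R]_(p, q)) : mx_derive E (fun=> B) (fun=> 0).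
Proof. by move=> s i j; rewrite mxE; exact: is_derive_cst. Qed.

Lemma mx_derive_id : mx_derive E (fun s => s) (fun=> E).
Proof.
move=> s i j; under eq_fun do rewrite !mxE.
by apply: is_derive_eq; rewrite scale0r !add0r mul1r /GRing.scale/= mulr1.
Qed.

Lemma mx_derive_tr p q (F F' : dom -> 'M[R]_(p, q)) :
  mx_derive E F F' -> mx_derive E (fun s => (F s)^T) (fun s => (F' s)^T).
Proof. by move=> dF s i j; rewrite mxE; under eq_fun do rewrite mxE; exact: dF. Qed.

Lemma mx_deriveM p q l (F F' : dom -> 'M[R]_(p, q)) (G G' : dom -> 'M[R]_(q, l)) :
  mx_derive E F F' -> mx_derive E G G' ->
  mx_derive E (fun s => F s *m G s) (fun s => F' s *m G s + F s *m G' s).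
Proof.
move=> dF dG s i j; under eq_fun do rewrite mxE.
rewrite !mxE -big_split/=.
rewrite (_ : (fun x : R => _) =
    \sum_(k < q) (fun x : R => F (s + x *: E) i k * G (s + x *: E) k j)); last first.
  by apply/funext => x; rewrite fct_sumE.
apply: is_derive_sum => k.
have := is_deriveM (dF s i k) (dG s k j); rewrite !scale0r !addr0.
move=> ?; apply: is_derive_eq; rewrite /GRing.scale/= addrC; congr (_ + _); exact: mulrC.
Qed.

Lemma mx_cont_cst p q (B : 'M[R]_(p, q)) : mx_cont E (fun=> B).
Proof. by move=> s i j; exact: cvg_cst. Qed.

Lemma mx_cont_tr p q (F : dom -> 'M[R]_(p, q)) :
  mx_cont E F -> mx_cont E (fun s => (F s)^T).
Proof. by move=> cF s i j; under eq_fun do rewrite mxE; exact: cF. Qed.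

Lemma mx_contD p q (F G : dom -> 'M[R]_(p, q)) :
  mx_cont E F -> mx_cont E G -> mx_cont E (fun s => F s + G s).
Proof.
by move=> cF cG s i j; under eq_fun do rewrite mxE; apply: cvgD; [exact: cF|exact: cG].
Qed.

Lemma mx_contN p q (F : dom -> 'M[R]_(p, q)) :
  mx_cont E F -> mx_cont E (fun s => - F s).
Proof. by move=> cF s i j; under eq_fun do rewrite mxE; apply: cvgN; exact: cF. Qed.

Lemma mx_contM p q l (F : dom -> 'M[R]_(p, q)) (G : dom -> 'M[R]_(q, l)) :
  mx_cont E F -> mx_cont E G -> mx_cont E (fun s => F s *m G s).
Proof.
move=> cF cG s i j; under eq_fun do rewrite mxE.
by apply: cvg_big => // [|k _]; [exact: add_continuous|apply: cvgM; [exact: cF|exact: cG]].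
Qed.

End matrix_functionals.

(** * Bounds and derivative of the ridge operator *)

Section ridge_calculus.
Context (R : realType) (m n d : nat).
Variable A : 'M[R]_(n, d).
Hypothesis kerA : forall v : 'cV[R]_d, A *m v = 0 -> v = 0.
Variable e : R.
Hypothesis e0 : 0 < e.
Local Notation dom := 'M[R]_(m, n).

Let u (s : dom) : ridge_gram A e s \in unitmx.
Proof. exact: ridge_gram_unit. Qed.

Local Notation L := (fun s : dom => ridge A e s).
Definition sketch_ridge (s : dom) := s *m ridge A e s.
Definition hat (s : dom) := s *m ridge A e s *m s^T.
Local Notation H := sketch_ridge.
Local Notation N := hat.

(** The resolvent identity gives L_jj >= e L_jj^2, hence L_jj <= 1/e, and then
    e L_kj^2 <= L_jj. *)
Lemma ridge_bound (s : dom) k j : `|ridge A e s k j| <= e^-1.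
Proof.
have HL := ridge_diag (u s) j.
have H0 : 0 <= \sum_i (s *m ridge A e s) i j ^+ 2 by apply: sumr_ge0 => i _; exact: sqr_ge0.
have Lk l : ridge A e s l j ^+ 2 <= \sum_k ridge A e s k j ^+ 2.
  by rewrite [leRHS](bigD1 l)//= lerDl; apply: sumr_ge0 => i _; exact: sqr_ge0.
have {H0} Lk' l : e * ridge A e s l j ^+ 2 <= ridge A e s j j.
  by rewrite HL ler_wpDl// ler_wpM2l ?(ltW e0).
have Ljj : ridge A e s j j <= e^-1.
  have := Lk' j; rewrite expr2 mulrA => Lj.
  have [L0|L0] := lerP (ridge A e s j j) 0; first by rewrite (le_trans L0)// invr_ge0 ltW.
  by rewrite -(ler_pM2l e0) divff ?gt_eqF// -(ler_pM2r L0) mul1r.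
rewrite -(@ler_pXn2r _ 2) ?nnegrE ?invr_ge0 ?(ltW e0)//.
rewrite real_normK ?num_real// -(ler_pM2l e0).
have -> : e * e^-1 ^+ 2 = e^-1 by rewrite expr2 mulrA divff ?gt_eqF// mul1r.
exact: le_trans (Lk' k) Ljj.
Qed.

Lemma le_sqr_bound (x c : R) : x ^+ 2 <= c -> `|x| <= 1 + c.
Proof.
rewrite -(real_normK (num_real x)) => xc.
by have := sqr_ge0 (1 - `|x|); have := normr_ge0 x; nra.
Qed.

Lemma sketch_ridge_bound (s : dom) i j : `|H s i j| <= 1 + e^-1.
Proof.
apply: le_sqr_bound; apply: le_trans (le_trans (ler_norm _) (ridge_bound s j j)).
rewrite ridge_diag// (bigD1 i)//= -addrA lerDl addr_ge0//.
  by apply: sumr_ge0 => k _; exact: sqr_ge0.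
by rewrite mulr_ge0 ?(ltW e0)//; apply: sumr_ge0 => k _; exact: sqr_ge0.
Qed.

Lemma hat_bound (s : dom) i j : `|N s i j| <= 2.
Proof.
have HN := hat_diag (u s) j.
have H0 : 0 <= e * \sum_l (s *m ridge A e s) j l ^+ 2.
  by rewrite mulr_ge0 ?(ltW e0)//; apply: sumr_ge0 => k _; exact: sqr_ge0.
have Nk l : N s l j ^+ 2 <= N s j j.
  rewrite /hat HN ler_wpDr// [leRHS](bigD1 l)//= lerDl.
  by apply: sumr_ge0 => k _; exact: sqr_ge0.
have Nj : N s j j <= 1 by have := Nk j; have := sqr_ge0 (1 - N s j j); nra.
by apply: le_sqr_bound; exact: le_trans (Nk i) Nj.
Qed.

Lemma ridge_growth : mx_growth 0 L.
Proof.
exists e^-1; first by rewrite invr_ge0 ltW.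
by move=> s i j; rewrite mulr1; exact: ridge_bound.
Qed.

Lemma sketch_ridge_growth : mx_growth 0 H.
Proof.
exists (1 + e^-1); first by rewrite addr_ge0// invr_ge0 ltW.
by move=> s i j; rewrite mulr1; exact: sketch_ridge_bound.
Qed.

Lemma hat_growth : mx_growth 0 N.
Proof. by exists 2 => // s i j; rewrite mulr1; exact: hat_bound. Qed.

Section direction.
Variable E : dom.

(** The difference of two ridge operators is L_e(s') (s^T s - s'^T s') L_e(s), where the
    first factor is bounded uniformly in s'. *)
Lemma ridge_cont : mx_cont E L.
Proof.
move=> s i j.
pose Y (s' : dom) := (s^T *m s - s'^T *m s') *m L s.
have cY : mx_cont E Y.
  apply: mx_contM; last exact: mx_cont_cst.
  apply: mx_contD; first exact: mx_cont_cst.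
  have cid : mx_cont E (fun s => s) by exact: mx_derive_cont (@mx_derive_id _ _ _ E).
  by apply: mx_contN; apply: mx_contM => //; exact: mx_cont_tr.
have Y0 : Y s = 0 by rewrite /Y subrr mul0mx.
have key x : `|L (s + x *: E) i j - L s i j| <= \sum_k e^-1 * `|Y (s + x *: E) k j|.
  have -> : L (s + x *: E) i j - L s i j = (L (s + x *: E) - L s) i j by rewrite !mxE.
  rewrite ridge_diff_sketch// -mulmxA mxE (le_trans (ler_norm_sum _ _ _))//.
  by apply: ler_sum => k _; rewrite normrM ler_wpM2r// ridge_bound.
have g0 : \sum_k e^-1 * `|Y (s + x *: E) k j| @[x --> (0:R)] --> (0 : R).
  rewrite [X in _ --> X](_ : 0 = \sum_k e^-1 * `|Y (s + 0 *: E) k j|); last first.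
    by rewrite big1// => k _; rewrite scale0r addr0 Y0 mxE normr0 mulr0.
  apply: cvg_big => [|k _]; first exact: add_continuous.
  by apply: cvgM; [exact: cvg_cst|apply: cvg_norm; exact: cY].
rewrite /continuous_at scale0r addr0.
apply: cvg_zero; apply/norm_cvg0P.
apply: squeeze_cvgr (cvg_cst 0) g0.
by near=> x; rewrite normr_ge0 /= key.
Unshelve. all: by end_near. Qed.

Definition dridge (s : dom) := - (L s *m (E^T *m s + s^T *m E) *m L s).

(** The derivative of S L in the direction E.  With H = S L and N = S L S^T, the product rule
    gives E L + S dL where S dL = - H E^T H - N E L. *)
Definition dsketch_ridge (s : dom) := E *m L s - H s *m E^T *m H s - N s *m E *m L s.

(** The difference quotient - L_e(s') (E^T s' + s^T E) L_e(s), s' = s + x E, is continuous at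
    x = 0 since the operator is. *)
Lemma ridge_derive : mx_derive E L dridge.
Proof.
move=> s i j; apply/is_derive1_caratheodory.
pose G (s' : dom) := - (L s' *m (E^T *m s' + s^T *m E) *m L s).
exists (fun x => G (s + x *: E) i j); split.
- move=> x; rewrite !subr0 scale0r addr0.
  have -> : L (s + x *: E) i j - L s i j = (L (s + x *: E) - L s) i j by rewrite !mxE.
  have zT : (s + x *: E)^T = s^T + x *: E^T by rewrite linearD/= linearZ.
  have zE : s^T *m s - (s + x *: E)^T *m (s + x *: E) =
      - (x *: (E^T *m (s + x *: E) + s^T *m E)).
    rewrite zT mulmxDl [s^T *m (s + _)]mulmxDr -scalemxAr -scalemxAl !opprD !addrA.
    by rewrite subrr add0r scalerDr opprD addrC.
  rewrite ridge_diff_sketch// zE mulmxN mulNmx -scalemxAr -scalemxAl -scalerN.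
  by rewrite [LHS]mxE mulrC.
- rewrite /prop_for; suff : mx_cont E G by apply.
  have cid : mx_cont E (fun s => s) by exact: mx_derive_cont (@mx_derive_id _ _ _ E).
  apply: mx_contN; apply: mx_contM; last exact: mx_cont_cst.
  apply: mx_contM; first exact: ridge_cont.
  apply: mx_contD; last exact: mx_cont_cst.
  by apply: mx_contM => //; exact: mx_cont_cst.
- by rewrite /G /dridge scale0r addr0.
Qed.

Lemma sketch_ridge_derive : mx_derive E H dsketch_ridge.
Proof.
have D := mx_deriveM (@mx_derive_id _ _ _ E) ridge_derive.
move=> s i j; apply: is_derive_eq (D s i j) _.
congr (fun_of_matrix _ i j).
rewrite /dsketch_ridge /dridge /sketch_ridge /hat mulmxN mulmxDr mulmxDl mulmxDr opprD addrA.
by rewrite !mulmxA.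
Qed.

Let cid : mx_cont E (fun s => s).
Proof. exact: mx_derive_cont (@mx_derive_id _ _ _ E). Qed.

Lemma sketch_ridge_cont : mx_cont E H.
Proof. exact: mx_derive_cont sketch_ridge_derive. Qed.

Lemma hat_cont : mx_cont E N.
Proof. by apply: mx_contM; [exact: sketch_ridge_cont|exact: mx_cont_tr]. Qed.

Lemma dsketch_ridge_cont : mx_cont E dsketch_ridge.
Proof.
have cE : mx_cont E (fun=> E) by exact: mx_cont_cst.
have cH := sketch_ridge_cont; have cL := ridge_cont; have cN := hat_cont.
apply: mx_contD; first apply: mx_contD.
- exact: mx_contM.
- by apply: mx_contN; apply: mx_contM => //; apply: mx_contM => //; exact: mx_cont_cst.
- by apply: mx_contN; apply: mx_contM => //; exact: mx_contM.
Qed.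

Lemma dsketch_ridge_growth : mx_growth 0 dsketch_ridge.
Proof.
have gE := mx_growth_cst m n E.
have gET := mx_growth_cst m n E^T.
have gH := sketch_ridge_growth; have gL := ridge_growth; have gN := hat_growth.
apply: mx_growthD; first apply: mx_growthD.
- exact: (mx_growthM gE gL).
- by apply: mx_growthN; exact: (mx_growthM (mx_growthM gH gET) gH).
- by apply: mx_growthN; exact: (mx_growthM (mx_growthM gN gE) gL).
Qed.

End direction.

Lemma sketch_ridge_measurable : mx_measurable H.
Proof. by apply: mx_measurableM; [exact: mx_measurable_id|exact: mx_measurable_ridge]. Qed.

Lemma hat_measurable : mx_measurable N.
Proof.
by apply: mx_measurableM; [exact: sketch_ridge_measurable|apply: mx_measurable_tr; exact: mx_measurable_id].
Qed.

Lemma dsketch_ridge_measurable E : mx_measurable (dsketch_ridge E).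
Proof.
have mE := mx_measurable_cst (m := m) (n := n) E.
have mET := mx_measurable_cst (m := m) (n := n) E^T.
have mH := sketch_ridge_measurable; have mL := @mx_measurable_ridge R m n d A e; have mN := hat_measurable.
apply: mx_measurableD; first apply: mx_measurableD.
- exact: (mx_measurableM mE mL).
- by apply: mx_measurableN; exact: (mx_measurableM (mx_measurableM mH mET) mH).
- by apply: mx_measurableN; exact: (mx_measurableM (mx_measurableM mN mE) mL).
Qed.

End ridge_calculus.

(** * Stein's identity for the ridge operator *)

Section real_integrals.
Context (disp : measure_display) (T : measurableType disp) (R : realType)
  (P : probability T R).

Lemma Rintegral_sumr (I : finType) (f : I -> T -> R) :
  (forall i, P.-integrable setT (EFin \o f i)) ->
  \int[P]_w (\sum_i f i w) = \sum_i \int[P]_w f i w.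
Proof.
move=> fi; rewrite /Rintegral.
under eq_integral do rewrite -sumEFin.
rewrite integral_sum//; apply: EFin_inj; rewrite fineK.
  by rewrite -sumEFin; apply: eq_bigr => i _; rewrite fineK//; exact: (integrable_fin_num measurableT (fi i)).
by apply/sum_fin_numP => i _ _; exact: (integrable_fin_num measurableT (fi i)).
Qed.

Lemma integrable_sumr (I : finType) (f : I -> T -> R) :
  (forall i, P.-integrable setT (EFin \o f i)) ->
  P.-integrable setT (EFin \o (fun w => \sum_i f i w)).
Proof.
move=> fi; rewrite (_ : EFin \o _ = fun w => (\sum_i (f i w)%:E)%E).
  by apply: integrable_sum => // i _; exact: fi.
by apply/funext => w /=; rewrite sumEFin.
Qed.

Lemma integrableZr_EFin (c : R) (f : T -> R) :
  P.-integrable setT (EFin \o f) -> P.-integrable setT (EFin \o (fun w => c * f w)).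
Proof.
move=> fi; rewrite (_ : EFin \o _ = fun w => (c%:E * (EFin \o f) w)%E); first exact: integrableZl.
by apply/funext => w /=; rewrite EFinM.
Qed.

Lemma integrableB_EFin (f g : T -> R) :
  P.-integrable setT (EFin \o f) -> P.-integrable setT (EFin \o g) ->
  P.-integrable setT (EFin \o (fun w => f w - g w)).
Proof.
move=> fi gi; rewrite (_ : EFin \o _ = (EFin \o f) \- (EFin \o g))%E //.
exact: integrableB.
Qed.

End real_integrals.

Section ridge_stein.
Context (disp : measure_display) (T : measurableType disp) (R : realType)
  (P : probability T R) (m n d : nat).
Variable S : 'I_m -> 'I_n -> {RV P >-> R}.
Hypothesis hS : gaussian_sketch S.
Hypothesis m0 : (0 < m)%N.
Variable A : 'M[R]_(n, d).
Hypothesis kerA : forall v : 'cV[R]_d, A *m v = 0 -> v = 0.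
Variable e : R.
Hypothesis e0 : 0 < e.
Local Notation dom := 'M[R]_(m, n).
Local Notation SS := (sketch_mx S).
Local Notation L := (ridge A e).
Local Notation H := (sketch_ridge A e).
Local Notation N := (hat A e).

Lemma mx_growth_le k k' p q (F : dom -> 'M[R]_(p, q)) : (k <= k')%N ->
  mx_growth k F -> mx_growth k' F.
Proof.
move=> kk' [C C0 FC]; exists C => // s i j; apply: (le_trans (FC s i j)).
by rewrite ler_wpM2l// ler_weXn2l// lerDl l1norm_ge0.
Qed.

Lemma integrable_mx_growth k p q (F : dom -> 'M[R]_(p, q)) i j : (k <= 2)%N ->
  mx_measurable F -> mx_growth k F ->
  P.-integrable setT (EFin \o (fun w => F (SS w) i j)).
Proof.
move=> k2 mF /(mx_growth_le k2) [C C0 FC].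
by apply: (integrable_quadratic_growth hS m0 (mF i j) (FC^~ i ^~ j)).
Qed.

Lemma stein_entry p q (F F' : dom -> 'M[R]_(p, q)) i j a b :
  mx_measurable F -> mx_measurable F' ->
  mx_derive (delta_mx i j) F F' -> mx_cont (delta_mx i j) F' ->
  mx_growth 1 F -> mx_growth 1 F' ->
  \int[P]_w (S i j w * F (SS w) a b) = m%:R^-1 * \int[P]_w F' (SS w) a b.
Proof.
move=> mF mF' dF cF' [C C0 FC] [C' C'0 FC'].
rewrite /Rintegral.
have -> : (\int[P]_w (S i j w * F (SS w) a b)%:E =
    m%:R^-1%:E * \int[P]_w (F' (SS w) a b)%:E)%E; last first.
  rewrite fineM//; apply: (integrable_fin_num measurableT).
  by apply: (integrable_mx_growth _ _ (k := 1)) => //; exists C'.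
apply: (@sketch_stein _ _ _ _ _ _ S hS m0 i j (fun s => F s a b) (fun s => F' s a b) (C + C')).
- exact: mF.
- exact: mF'.
- by move=> s; exact: dF.
- by move=> s; exact: cF'.
- move=> s; apply: (le_trans (FC s a b)); rewrite expr1 ler_wpM2r ?lerDl//.
  by rewrite addr_ge0// l1norm_ge0.
- move=> s; apply: (le_trans (FC' s a b)); rewrite expr1 ler_wpM2r ?lerDr//.
  by rewrite addr_ge0// l1norm_ge0.
Qed.

Lemma integrable_entryM k p q (F : dom -> 'M[R]_(p, q)) i j a b : (k <= 1)%N ->
  mx_measurable F -> mx_growth k F ->
  P.-integrable setT (EFin \o (fun w => S i j w * F (SS w) a b)).
Proof.
move=> k1 mF gF.
have -> : EFin \o (fun w => S i j w * F (SS w) a b) =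
    EFin \o (fun w => (fun s : dom => (s i j *: F s) a b) (SS w)).
  by apply/funext => w /=; rewrite !mxE.
have [C C0 FC] := mx_growth_le k1 gF.
apply: (integrable_quadratic_growth hS m0 (C := C) (Phi := fun s : dom => (s i j *: F s) a b)).
  move=> dd U s ms; under eq_fun do rewrite mxE.
  by apply: measurable_funM => //; exact: mF.
move=> s; rewrite mxE normrM expr2 mulrCA; apply: ler_pM => //.
by rewrite (le_trans (entry_le_l1norm s i j))// lerDr.
Qed.

Definition frob (s : dom) := \sum_j \sum_k ridge A e s k j ^+ 2.

Let u (s : dom) : ridge_gram A e s \in unitmx.
Proof. exact: ridge_gram_unit. Qed.

Lemma sum_sketch_ridge_sqr (s : dom) :
  \sum_i \sum_j H s i j ^+ 2 = \tr (L s) - e * frob s.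
Proof.
rewrite exchange_big/= /frob mulr_sumr -sumrB; apply: eq_bigr => j _.
by rewrite ridge_diag// addrK.
Qed.

Lemma sum_entry_sketch_ridge (s : dom) :
  \sum_i \sum_j s i j * H s i j = d%:R - e * \tr (L s).
Proof.
rewrite -(mxtrace_sketch_ridge (u s)) /mxtrace; apply: eq_bigr => i _.
rewrite [RHS]mxE; apply: eq_bigr => j _; rewrite mulrC; congr (_ * _).
by rewrite mxE.
Qed.

Lemma mul_delta_mxE (p q l : nat) (a : 'I_p) (b : 'I_q) (B : 'M[R]_(q, l)) i j :
  (delta_mx a b *m B) i j = (i == a)%:R * B b j.
Proof.
rewrite mxE (bigD1 b)//= mxE eqxx andbT big1 ?addr0// => k kb.
by rewrite mxE (negbTE kb) andbF mul0r.
Qed.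

Lemma mul_mx_delta_mulE (p q l r : nat) (a : 'I_p) (b : 'I_q) (C : 'M[R]_(r, p))
    (B : 'M[R]_(q, l)) i j : (C *m (delta_mx a b *m B)) i j = C i a * B b j.
Proof.
rewrite mxE (bigD1 a)//= mul_delta_mxE eqxx mul1r big1 ?addr0// => k ka.
by rewrite mul_delta_mxE (negbTE ka) mul0r mulr0.
Qed.

(** These are the terms of the divergence of the field S L. *)
Lemma dsketch_ridge_delta (s : dom) i j :
  dsketch_ridge A e (delta_mx i j) s i j = L s j j - H s i j ^+ 2 - N s i i * L s j j.
Proof.
rewrite /dsketch_ridge 2!entryB mul_delta_mxE eqxx mul1r; congr (_ - _ - _).
- have -> : (delta_mx i j)^T = delta_mx j i :> 'M[R]_(n, m) by rewrite trmx_delta.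
  by rewrite -mulmxA mul_mx_delta_mulE expr2.
- by rewrite -mulmxA mul_mx_delta_mulE.
Qed.

Lemma sum_dsketch_ridge_delta (s : dom) :
  \sum_i \sum_j dsketch_ridge A e (delta_mx i j) s i j =
  (m%:R - 1 - d%:R) * \tr (L s) + e * frob s + e * \tr (L s) ^+ 2.
Proof.
transitivity (m%:R * \tr (L s) - (\tr (L s) - e * frob s) -
              (d%:R - e * \tr (L s)) * \tr (L s)); last by ring.
rewrite -sum_sketch_ridge_sqr -(mxtrace_sketch_ridge (u s)).
have -> : m%:R * \tr (L s) = \sum_(i < m) \sum_j L s j j.
  by rewrite sumr_const card_ord mulr_natl.
rewrite [X in _ - _ - X]mulr_suml -!sumrB; apply: eq_bigr => i _.
rewrite mulr_sumr -!sumrB; apply: eq_bigr => j _.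
by rewrite dsketch_ridge_delta.
Qed.

Lemma integrable_trace : P.-integrable setT (EFin \o (fun w => \tr (L (SS w)))).
Proof.
apply: integrable_sumr => i; apply: (integrable_mx_growth _ _ (k := 0)) => //.
  exact: mx_measurable_ridge.
exact: ridge_growth.
Qed.

Lemma integrable_residual_trace :
  P.-integrable setT (EFin \o (fun w => \tr (L (SS w)) - e * frob (SS w))).
Proof.
under eq_fun do rewrite -sum_sketch_ridge_sqr.
have mH : mx_measurable (H : dom -> _) by exact: sketch_ridge_measurable.
have gH : mx_growth 0 (H : dom -> _) by exact: sketch_ridge_growth.
have -> : (fun w => \sum_i \sum_j H (SS w) i j ^+ 2) =
          (fun w => \sum_i (H (SS w) *m (H (SS w))^T) i i).
  apply/funext => w; apply: eq_bigr => i _; rewrite [RHS]mxE.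
  by apply: eq_bigr => j _; rewrite expr2; congr (_ * _); rewrite [RHS]mxE.
apply: integrable_sumr => i.
apply: (integrable_mx_growth _ _ (k := 0) (F := fun s => H s *m (H s)^T)) => //.
  by apply: mx_measurableM => //; exact: mx_measurable_tr.
exact: (mx_growthM gH (mx_growth_tr gH)).
Qed.

(** Stein's identity for the bounded field S L.  The left-hand side is the sum of the
    S_ij (S L)_ij, that is tr (S L S^T). *)
Lemma stein_trace :
  \int[P]_w (d%:R - e * \tr (L (SS w))) = m%:R^-1 *
  \int[P]_w ((m%:R - 1 - d%:R) * \tr (L (SS w)) + e * frob (SS w) + e * \tr (L (SS w)) ^+ 2).
Proof.
have mH : mx_measurable (H : dom -> _) by exact: sketch_ridge_measurable.
have gH : mx_growth 0 (H : dom -> _) by exact: sketch_ridge_growth.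
have gD E : mx_growth 0 (dsketch_ridge A e E : dom -> _) by exact: dsketch_ridge_growth.
have mD E : mx_measurable (dsketch_ridge A e E : dom -> _) by exact: dsketch_ridge_measurable.
under eq_Rintegral do rewrite -sum_entry_sketch_ridge.
under [in RHS]eq_Rintegral do rewrite -sum_dsketch_ridge_delta.
have iH i j : P.-integrable setT (EFin \o (fun w => SS w i j * H (SS w) i j)).
  have -> : EFin \o (fun w => SS w i j * H (SS w) i j) =
            EFin \o (fun w => S i j w * H (SS w) i j).
    by apply/funext => w /=; rewrite [SS w i j]mxE.
  by apply: (integrable_entryM (k := 0)).
have iD i j : P.-integrable setT (EFin \o (fun w => dsketch_ridge A e (delta_mx i j) (SS w) i j)).
  exact: (integrable_mx_growth _ _ (k := 0)).
rewrite !Rintegral_sumr; try by move=> i; exact: integrable_sumr.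
rewrite mulr_sumr; apply: eq_bigr => i _.
rewrite !Rintegral_sumr// mulr_sumr; apply: eq_bigr => j _.
transitivity (\int[P]_w (S i j w * H (SS w) i j)).
  by apply: eq_Rintegral => w _; rewrite [SS w i j]mxE.
apply: stein_entry => //.
- exact: sketch_ridge_derive.
- exact: dsketch_ridge_cont.
- exact: mx_growth_le gH.
- exact: mx_growth_le (gD _).
Qed.


Section residual.
Variable r : 'cV[R]_n.
Hypothesis Ar : A^T *m r = 0.

(** The fitted values of the sketched ridge regression of r on the columns of A. *)
Definition ridge_fit (s : dom) : 'cV[R]_n := ridge A e s *m (s^T *m (s *m r)).

(* r_j V_i is the field whose pairing with S is the squared norm of the fitted values *)
Let V (s : dom) : 'cV[R]_m := H s *m (H s)^T *m (s *m r).

Let dV (E s : dom) : 'cV[R]_m :=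
  (dsketch_ridge A e E s *m (H s)^T + H s *m (dsketch_ridge A e E s)^T) *m (s *m r) +
  H s *m (H s)^T *m (E *m r).

(** The sum is the derivative of S L in the direction whose row i is r^T; every term of it
    contains L r, which vanishes because A^T r = 0. *)
Lemma sum_dsketch_ridge_ortho (s : dom) i :
  \sum_j r j 0 *: dsketch_ridge A e (delta_mx i j) s = 0.
Proof.
have Lr l : \sum_j r j 0 * L s j l = 0.
  transitivity ((L s *m r) l 0); last by rewrite ridge_ortho// mxE.
  by rewrite [RHS]mxE; apply: eq_bigr => j _; rewrite mulrC -{1}(ridge_tr (u s)) mxE.
have Hr k : \sum_j r j 0 * H s k j = 0.
  transitivity ((H s *m r) k 0); last by rewrite /sketch_ridge -mulmxA ridge_ortho// mulmx0 mxE.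
  by rewrite [RHS]mxE; apply: eq_bigr => j _; rewrite mulrC.
apply/matrixP => k l; rewrite summxE [RHS]mxE.
transitivity ((k == i)%:R * \sum_j r j 0 * L s j l - (\sum_j r j 0 * H s k j) * H s i l -
   N s k i * \sum_j r j 0 * L s j l); last by rewrite Lr Hr !mulr0 mul0r !subr0.
rewrite mulr_suml !mulr_sumr -!sumrB; apply: eq_bigr => j _.
rewrite entryZ /dsketch_ridge 2!entryB mul_delta_mxE.
have -> : (delta_mx i j)^T = delta_mx j i :> 'M[R]_(n, m) by rewrite trmx_delta.
by rewrite -mulmxA mul_mx_delta_mulE -mulmxA mul_mx_delta_mulE; ring.
Qed.

Lemma sum_dV (s : dom) :
  \sum_i \sum_j r j 0 * dV (delta_mx i j) s i 0 =
  (\sum_j r j 0 ^+ 2) * (\tr (L s) - e * frob s).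
Proof.
rewrite -sum_sketch_ridge_sqr mulr_sumr; apply: eq_bigr => i _.
have Z : \sum_j r j 0 *: ((dsketch_ridge A e (delta_mx i j) s *m (H s)^T +
     H s *m (dsketch_ridge A e (delta_mx i j) s)^T) *m (s *m r)) = 0.
  transitivity (((\sum_j r j 0 *: dsketch_ridge A e (delta_mx i j) s) *m (H s)^T +
     H s *m (\sum_j r j 0 *: dsketch_ridge A e (delta_mx i j) s)^T) *m (s *m r)).
    rewrite mulmx_suml linear_sum/= mulmx_sumr -big_split/= mulmx_suml.
    apply: eq_bigr => j _.
    by rewrite linearZ/= -scalemxAr -scalemxAl -scalerDr -scalemxAl.
  by rewrite sum_dsketch_ridge_ortho trmx0 mul0mx mulmx0 addr0 mul0mx.
transitivity ((\sum_j r j 0 *: ((dsketch_ridge A e (delta_mx i j) s *m (H s)^T +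
     H s *m (dsketch_ridge A e (delta_mx i j) s)^T) *m (s *m r))) i 0 +
     \sum_j r j 0 * (H s *m (H s)^T *m (delta_mx i j *m r)) i 0).
  rewrite summxE -big_split/=; apply: eq_bigr => j _.
  by rewrite /dV entryD mulrDr entryZ.
rewrite Z [X in X + _]mxE add0r.
have -> : \sum_j H s i j ^+ 2 = (H s *m (H s)^T) i i.
  by rewrite [RHS]mxE; apply: eq_bigr => j _; rewrite expr2; congr (_ * _); rewrite [RHS]mxE.
rewrite mulr_suml; apply: eq_bigr => j _.
by rewrite mul_mx_delta_mulE; ring.
Qed.

Lemma sum_entry_V (s : dom) :
  \sum_i \sum_j r j 0 * (s i j * V s i 0) = \sum_k ridge_fit s k 0 ^+ 2.
Proof.
have fitE : ridge_fit s = (H s)^T *m (s *m r).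
  by rewrite /ridge_fit /sketch_ridge trmx_mul ridge_tr// !mulmxA.
rewrite fitE -sumsq_mulmx trmx_mul trmxK.
have -> : (s *m r)^T *m H s *m ((H s)^T *m (s *m r)) = (s *m r)^T *m V s.
  by rewrite /V !mulmxA.
rewrite [RHS]mxE; apply: eq_bigr => i _.
have -> : (s *m r)^T 0 i = \sum_j s i j * r j 0 by rewrite !mxE.
rewrite mulr_suml; apply: eq_bigr => j _.
by rewrite mulrA [r j 0 * _]mulrC.
Qed.

(** Stein's identity for the field r_j V_i, where V = (S L) (S L)^T S r: orthogonality of r
    to the range of A leaves only the derivative of the factor S r. *)
Lemma stein_residual :
  \int[P]_w (\sum_k ridge_fit (SS w) k 0 ^+ 2) =
  (\sum_j r j 0 ^+ 2) * m%:R^-1 * \int[P]_w (\tr (L (SS w)) - e * frob (SS w)).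
Proof.
have mH : mx_measurable (H : dom -> _) by exact: sketch_ridge_measurable.
have gH : mx_growth 0 (H : dom -> _) by exact: sketch_ridge_growth.
have gD E : mx_growth 0 (dsketch_ridge A e E : dom -> _) by exact: dsketch_ridge_growth.
have mD E : mx_measurable (dsketch_ridge A e E : dom -> _) by exact: dsketch_ridge_measurable.
have mr : mx_measurable (fun s : dom => s *m r).
  by apply: mx_measurableM; [exact: mx_measurable_id|exact: mx_measurable_cst].
have gr : mx_growth 1 (fun s : dom => s *m r).
  exact: (mx_growthM (@mx_growth_id _ _ _) (mx_growth_cst m n r)).
have mHH : mx_measurable (fun s : dom => H s *m (H s)^T).
  by apply: mx_measurableM => //; exact: mx_measurable_tr.
have gHH : mx_growth 0 (fun s : dom => H s *m (H s)^T).
  exact: (mx_growthM gH (mx_growth_tr gH)).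
have mV : mx_measurable V by exact: mx_measurableM.
have gV : mx_growth 1 V by exact: (mx_growthM gHH gr).
have mdV E : mx_measurable (dV E).
  apply: mx_measurableD; last by apply: mx_measurableM => //; exact: mx_measurable_cst.
  apply: mx_measurableM => //; apply: mx_measurableD; apply: mx_measurableM => //;
    try exact: mx_measurable_tr.
have gdV E : mx_growth 1 (dV E).
  apply: mx_growthD; last first.
    exact: mx_growth_le (mx_growthM gHH (mx_growth_cst m n (E *m r))).
  apply: (mx_growthM (k := 0)) => //; apply: mx_growthD.
    exact: (mx_growthM (gD E) (mx_growth_tr gH)).
  exact: (mx_growthM gH (mx_growth_tr (gD E))).
have ddV E : mx_derive E V (dV E).
  have dH := sketch_ridge_derive kerA e0 E.
  have dr : mx_derive E (fun s : dom => s *m r) (fun s => E *m r + s *m 0).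
    by apply: mx_deriveM; [exact: mx_derive_id|exact: mx_derive_cst].
  have D := mx_deriveM (mx_deriveM dH (mx_derive_tr dH)) dr.
  move=> s i j; apply: is_derive_eq (D s i j) _.
  by rewrite mulmx0 addr0.
have cdV E : mx_cont E (dV E).
  have cH : mx_cont E (H : dom -> _) by exact: sketch_ridge_cont.
  have cD : mx_cont E (dsketch_ridge A e E : dom -> _) by exact: dsketch_ridge_cont.
  have cr : mx_cont E (fun s : dom => s *m r).
    apply: mx_contM; last exact: mx_cont_cst.
    exact: mx_derive_cont (@mx_derive_id _ _ _ E).
  apply: mx_contD; apply: mx_contM => //; last exact: mx_cont_cst.
    by apply: mx_contD; apply: mx_contM => //; exact: mx_cont_tr.
  by apply: mx_contM => //; exact: mx_cont_tr.
have -> : (\sum_j r j 0 ^+ 2) * m%:R^-1 * \int[P]_w (\tr (L (SS w)) - e * frob (SS w)) =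
    m%:R^-1 * \int[P]_w (\sum_i \sum_j r j 0 * dV (delta_mx i j) (SS w) i 0).
  rewrite [_ * m%:R^-1]mulrC -mulrA; congr (_ * _).
  rewrite -RintegralZl//; last first.
    apply: integrable_residual_trace.
  by apply: eq_Rintegral => w _; rewrite sum_dV.
under eq_Rintegral do rewrite -sum_entry_V.
have iV0 i j : P.-integrable setT (EFin \o (fun w => SS w i j * V (SS w) i 0)).
  have -> : EFin \o (fun w => SS w i j * V (SS w) i 0) =
            EFin \o (fun w => S i j w * V (SS w) i 0).
    by apply/funext => w /=; rewrite [SS w i j]mxE.
  by apply: (integrable_entryM (k := 1)).
have iV i j : P.-integrable setT (EFin \o (fun w => r j 0 * (SS w i j * V (SS w) i 0))).
  exact: integrableZr_EFin.
have idV i j : P.-integrable setT (EFin \o (fun w => r j 0 * dV (delta_mx i j) (SS w) i 0)).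
  apply: integrableZr_EFin.
  exact: (integrable_mx_growth _ _ (k := 1)).
rewrite !Rintegral_sumr; try by move=> i; exact: integrable_sumr.
rewrite mulr_sumr; apply: eq_bigr => i _.
rewrite !Rintegral_sumr// mulr_sumr; apply: eq_bigr => j _.
have idV0 : P.-integrable setT (EFin \o (fun w => dV (delta_mx i j) (SS w) i 0)).
  exact: (integrable_mx_growth _ _ (k := 1)).
rewrite (RintegralZl _ _ (iV0 i j))// (RintegralZl _ _ idV0)//.
rewrite mulrCA; congr (_ * _).
transitivity (\int[P]_w (S i j w * V (SS w) i 0)).
  by apply: eq_Rintegral => w _; rewrite [SS w i j]mxE.
exact: stein_entry.
Qed.

End residual.
End ridge_stein.

(** * Limits of the regularised expectations *)

Section limits_of_integrals.
Context (disp : measure_display) (T : measurableType disp) (R : realType)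
  (P : probability T R).
Variables (f_ : nat -> T -> R) (f : T -> R).
Hypothesis fi : forall k, P.-integrable setT (EFin \o f_ k).
Hypothesis mf : measurable_fun setT f.
Hypothesis cvgf : {ae P, forall w, f_ ^~ w @ \oo --> f w}.

(** Fatou's lemma for almost sure convergence: off a null set the functions are cut to 0. *)
Lemma integrable_fatou (K : R) : (forall k w, 0 <= f_ k w) ->
  (forall k, \int[P]_w f_ k w <= K) -> P.-integrable setT (EFin \o f).
Proof.
move=> f0 fK.
have [N [mN N0 subN]] := cvgf.
have fin k : (\int[P]_w (f_ k w)%:E <= K%:E)%E.
  have := integrable_fin_num measurableT (fi k) => /fineK <-.
  by rewrite lee_fin; exact: fK.
pose g k w := (f_ k w * \1_(~` N) w)%:E.
pose h w := (f w * \1_(~` N) w)%:E.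
have mNC : measurable (~` N) by exact: measurableC.
have mfk k : measurable_fun setT (f_ k).
  exact/measurable_EFinP/(measurable_int _ (fi k)).
have mg k : measurable_fun setT (g k).
  apply/measurable_EFinP; apply: measurable_funM => //.
have g0 k w : setT w -> (0 <= g k w)%E.
  by move=> _; rewrite lee_fin mulr_ge0// indicE.
have gh w : g ^~ w @ \oo --> h w.
  apply: cvg_EFin; first by near=> k.
  rewrite /h /g /=; have [Nw|Nw] := pselect (N w).
    rewrite indicE memNset ?mulr0; last by [].
    by under eq_fun do rewrite /= mulr0; exact: cvg_cst.
  apply: cvgM; last exact: cvg_cst.
  by apply: contrapT => H; apply: Nw; apply: subN.
have h0 w : (0 <= h w)%E.
  rewrite -(cvg_lim _ (gh w))//; apply: lime_ge; first by apply/cvg_ex; exists (h w).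
  by near=> k; exact: g0.
have hE w : limn_einf (g ^~ w) = h w by rewrite is_cvg_limn_einfE; [exact/cvg_lim|apply/cvg_ex; exists (h w)].
have inth : (\int[P]_w h w <= K%:E)%E.
  rewrite -(eq_integral _ _ (fun w _ => hE w)).
  apply: (le_trans (fatou _ measurableT mg g0)).
  rewrite limn_einf_lim; apply: lime_le; first exact: is_cvg_einfs.
  near=> k; apply: (@le_trans _ _ (\int[P]_w g k w)%E).
    by apply: ereal_inf_lbound; exists k => //=.
  apply: le_trans (fin k); apply: ge0_le_integral => //.
  - exact: g0.
  - exact/measurable_EFinP.
  - by move=> w _; rewrite lee_fin ler_piMr// indicE.
apply/integrableP; split; first exact/measurable_EFinP.
apply: (@le_lt_trans _ _ (\int[P]_w h w)%E); last exact: le_lt_trans inth (ltry _).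
rewrite le_eqVlt; apply/orP; left; apply/eqP.
apply: ae_eq_integral => //.
- by apply: measurableT_comp => //; exact/measurable_EFinP.
- by apply/measurable_EFinP; exact: measurable_funM.
- exists N; split => // w /= H; apply: contrapT => Nw; apply: H => _.
  rewrite -[RHS]gee0_abs// /h indicE mem_set//= mulr1//.
Unshelve. all: by end_near. Qed.

Lemma cvg_Rintegral (g : T -> R) : P.-integrable setT (EFin \o g) ->
  {ae P, forall w, forall k, `|f_ k w| <= g w} ->
  \int[P]_w f_ k w @[k --> \oo] --> \int[P]_w f w.
Proof.
move=> ig fg.
have [|||||fint _ cv] := @dominated_convergence _ _ _ P setT measurableT
  (fun k => EFin \o f_ k) (EFin \o f) (EFin \o g).
- by move=> k; exact: measurable_int (fi k).
- exact/measurable_EFinP.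
- apply: filterS cvgf => w cw _; apply: cvg_EFin => //; by near=> k.
- by [].
- by apply: filterS fg => w H k _; rewrite lee_fin.
have /fineK E := integrable_fin_num measurableT fint.
by apply: fine_cvg; rewrite /= E.
Unshelve. all: by end_near. Qed.

End limits_of_integrals.

Section ridge_limit.
Context (R : realType) (m n d : nat).
Variable A : 'M[R]_(n, d).
Hypothesis kerA : forall v : 'cV[R]_d, A *m v = 0 -> v = 0.
Variable s : 'M[R]_(m, n).
Local Notation L := (fun e => ridge A e s).

Let sumsq_ge0 (I : finType) (f : I -> R) : 0 <= \sum_i f i ^+ 2.
Proof. by apply: sumr_ge0 => i _; exact: sqr_ge0. Qed.

Section positive.
Variable e : R.
Hypothesis e0 : 0 < e.

Let u : ridge_gram A e s \in unitmx. Proof. exact: ridge_gram_unit. Qed.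

Lemma ridge_diag_ge0 j : 0 <= L e j j.
Proof. by rewrite ridge_diag// addr_ge0// mulr_ge0// ltW. Qed.

Lemma trace_ridge_ge0 : 0 <= \tr (L e).
Proof. by apply: sumr_ge0 => j _; exact: ridge_diag_ge0. Qed.

Lemma frob_ge0 : 0 <= frob A e s.
Proof. by apply: sumr_ge0. Qed.

Lemma trace_sub_frob_ge0 : 0 <= \tr (L e) - e * frob A e s.
Proof. by rewrite -sum_sketch_ridge_sqr//; apply: sumr_ge0. Qed.

Lemma trace_ridge_le : e * \tr (L e) <= d%:R.
Proof.
rewrite -subr_ge0 -(mxtrace_sketch_ridge u); apply: sumr_ge0 => i _.
by rewrite hat_diag// addr_ge0// mulr_ge0// ltW.
Qed.

(** If W v = 0 with v nonzero then a = A v is nonzero and e L_e a = a, whereas the entries of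
    e L_e are at most b, the square root of e tr L_e.  Summing |a_j| <= b sum_k |a_k| over
    the n rows gives 1 <= n b. *)
Lemma ridge_singular : ridge_gram A 0 s \notin unitmx ->
  1 <= n%:R ^+ 2 * (e * \tr (L e)).
Proof.
move=> /negP nu.
have [v [gv v0]] : exists v : 'cV[R]_d, ridge_gram A 0 s *m v = 0 /\ v != 0.
  apply: contrapT => H; apply: nu; apply: unitmx_ker0 => v gv.
  by apply: contrapT => /eqP v0; apply: H; exists v.
pose a := A *m v.
have ea : e *: (L e *m a) = a.
  rewrite ridgeE// /a -!mulmxA scalemxAr; congr (_ *m _).
  have -> : A^T *m (A *m v) = e^-1 *: (ridge_gram A e s *m v).
    have -> : ridge_gram A e s = ridge_gram A 0 s + e *: (A^T *m A).
      by rewrite /ridge_gram scale0r addr0.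
    by rewrite mulmxDl gv add0r -scalemxAl scalerA mulVf ?gt_eqF// scale1r mulmxA.
  by rewrite -scalemxAr mulmxA mulVmx// mul1mx scalerA divff ?gt_eqF// scale1r.
have asum : 0 < \sum_j `|a j 0|.
  rewrite lt_def sumr_ge0// andbT; apply: contra_neq v0 => a0.
  apply: kerA; apply/matrixP => j k; rewrite ord1 [RHS]mxE.
  move/eqP: a0; rewrite psumr_eq0// => /allP/(_ j (mem_index_enum _)).
  by rewrite normr_eq0 => /eqP.
pose b := Num.sqrt (e * \tr (L e)).
have Lb j k : e * `|L e j k| <= b.
  rewrite -[X in X * _](ger0_norm (ltW e0)) -normrM -sqrtr_sqr ler_wsqrtr//.
  rewrite exprMn expr2 -mulrA ler_wpM2l ?(ltW e0)//.
  apply: (@le_trans _ _ (L e k k)).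
    rewrite [leRHS]ridge_diag// ler_wpDl// ler_wpM2l ?(ltW e0)//.
    by rewrite [leRHS](bigD1 j)//= lerDl; apply: sumr_ge0 => i _; exact: sqr_ge0.
  rewrite /mxtrace [leRHS](bigD1 k)//= lerDl; apply: sumr_ge0 => i _; exact: ridge_diag_ge0.
have b1 : 1 <= n%:R * b.
  rewrite -(ler_pM2r asum) mul1r.
  apply: (@le_trans _ _ (\sum_(j < n) \sum_k b * `|a k 0|)).
    apply: ler_sum => j _; rewrite -{1}ea mxE mxE mulr_sumr.
    apply: (le_trans (ler_norm_sum _ _ _)); apply: ler_sum => k _.
    by rewrite mulrA !normrM (ger0_norm (ltW e0)) ler_wpM2r.
  by rewrite sumr_const card_ord -mulr_sumr -[leLHS]mulr_natl mulrA.
have et0 : 0 <= e * \tr (L e) by rewrite mulr_ge0 ?(ltW e0)// trace_ridge_ge0.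
rewrite -(sqr_sqrtr et0) -exprMn -[leLHS](expr1n _ 2).
by rewrite lerXn2r// ?nnegrE// (le_trans _ b1).
Qed.

Section regular.
Hypothesis u0 : ridge_gram A 0 s \in unitmx.
Local Notation L0 := (ridge A 0 s).

Lemma ridge0_psd p (B : 'M[R]_(n, p)) j : 0 <= (B^T *m (L0 *m B)) j j.
Proof.
rewrite -(ridge_resolvent u0) scale0r addr0.
have -> : B^T *m (L0 *m s^T *m (s *m L0) *m B) = (s *m L0 *m B)^T *m (s *m L0 *m B).
  by rewrite trmx_mul [(s *m L0)^T]trmx_mul ridge_tr// !mulmxA.
by rewrite sumsq_mulmx.
Qed.

Lemma ridge0_sub : L0 - L e = e *: (L0 *m L e).
Proof. by rewrite ridge_diff// subr0. Qed.

(** L_0 B = Z + e L_0 Z for Z = L_e B; expand the square and use that L_0 is positive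
    semidefinite. *)
Lemma ridge_contract p (B : 'M[R]_(n, p)) j :
  \sum_i (L e *m B) i j ^+ 2 <= \sum_i (L0 *m B) i j ^+ 2.
Proof.
set Z := L e *m B.
have -> : L0 *m B = Z + e *: (L0 *m Z).
  by rewrite /Z mulmxA scalemxAl -mulmxDl -ridge0_sub subrKC.
have -> : \sum_i (Z + e *: (L0 *m Z)) i j ^+ 2 =
    \sum_i Z i j ^+ 2 + 2 * e * (Z^T *m (L0 *m Z)) j j + e ^+ 2 * \sum_i (L0 *m Z) i j ^+ 2.
  rewrite [(Z^T *m _) j j]mxE !mulr_sumr -!big_split/=; apply: eq_bigr => i _.
  rewrite entryD entryZ; have -> : Z^T j i = Z i j by rewrite mxE.
  by ring.
rewrite -addrA lerDl addr_ge0//; last by rewrite mulr_ge0// sqr_ge0.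
by rewrite mulr_ge0 ?ridge0_psd// mulr_ge0// ltW.
Qed.

(** L_0 = L_e + e L_e^2 + e^2 L_e L_0 L_e, and the last term is positive semidefinite. *)
Lemma trace_ridge0_ge : \tr (L e) + e * frob A e s <= \tr L0.
Proof.
have E : L0 = L e + e *: (L e *m L e) + e ^+ 2 *: (L e *m (L0 *m L e)).
  have c : L0 *m L e = L e *m L0.
    have := ridge_diff u0 u; rewrite sub0r -opprB ridge0_sub scaleNr.
    by move=> /oppr_inj /(scalerI (lt0r_neq0 e0)).
  have h : L0 = L e + e *: (L0 *m L e) by rewrite -ridge0_sub subrKC.
  transitivity (L e + e *: (L e *m (L e + e *: (L0 *m L e)))).
    by rewrite -h -c -h.
  by rewrite mulmxDr scalerDr -scalemxAr scalerA -expr2 addrA.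
move/(congr1 mxtrace) : E => ->; rewrite mxtraceD mxtraceD !mxtraceZ -addrA lerD2l.
apply: ler_wpDr.
  rewrite mulr_ge0 ?sqr_ge0//; apply: sumr_ge0 => j _.
  by rewrite -{1}(ridge_tr u) ridge0_psd.
rewrite ler_wpM2l ?(ltW e0)// /frob /mxtrace; apply: ler_sum => j _.
by rewrite -[X in X *m _](ridge_tr u) sumsq_mulmx.
Qed.

End regular.
End positive.

(** L_0 B - L_e B = e L_0 (L_e B), where L_e B is bounded in e by contraction. *)
Lemma ridge_cvg p (B : 'M[R]_(n, p)) i j : ridge_gram A 0 s \in unitmx ->
  (L k.+1%:R^-1 *m B) i j @[k --> \oo] --> (ridge A 0 s *m B) i j.
Proof.
move=> u0.
pose L0 := ridge A 0 s.
pose C := \sum_l `|L0 i l| * (1 + \sum_k (L0 *m B) k j ^+ 2).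
have ek k : 0 < k.+1%:R^-1 :> R by rewrite invr_gt0.
have key k : `|(L k.+1%:R^-1 *m B) i j - (L0 *m B) i j| <= C * k.+1%:R^-1.
  set e := k.+1%:R^-1; have e0 : 0 < e := ek k.
  have -> : (L e *m B) i j - (L0 *m B) i j = - (e * (L0 *m (L e *m B)) i j).
    rewrite -entryB -entryZ -entryN; congr (fun_of_matrix _ i j).
    by rewrite -mulmxBl mulmxA scalemxAl -ridge0_sub// -[RHS]mulNmx opprB.
  rewrite normrN normrM (ger0_norm (ltW e0)) mulrC ler_wpM2r ?(ltW e0)//.
  rewrite mxE (le_trans (ler_norm_sum _ _ _))//; apply: ler_sum => l _.
  rewrite normrM ler_wpM2l//; apply: le_sqr_bound.
  apply: le_trans (ridge_contract e0 u0 B j).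
  by rewrite [leRHS](bigD1 l)//= lerDl; apply: sumr_ge0 => a _; exact: sqr_ge0.
apply: cvg_zero; apply/norm_cvg0P.
apply: (@squeeze_cvgr _ _ _ _ (cst 0) (fun k => C * k.+1%:R^-1)).
- by near=> k; rewrite normr_ge0/= key.
- exact: cvg_cst.
- rewrite -[X in _ --> X](mulr0 C); apply: cvgM; first exact: cvg_cst.
  exact: cvg_harmonic.
Unshelve. all: by end_near. Qed.

End ridge_limit.

Section expectation_limits.
Context (disp : measure_display) (T : measurableType disp) (R : realType)
  (P : probability T R) (m n d : nat).
Variable S : 'I_m -> 'I_n -> {RV P >-> R}.
Hypothesis hS : gaussian_sketch S.
Hypothesis hm : (d + 1 < m)%N.
Variable A : 'M[R]_(n, d).
Hypothesis kerA : forall v : 'cV[R]_d, A *m v = 0 -> v = 0.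
Local Notation dom := 'M[R]_(m, n).
Local Notation SS := (sketch_mx S).
Local Notation t e := (fun w => \tr (ridge A e (SS w))).
Local Notation g e := (fun w => \tr (ridge A e (SS w)) - e * frob A e (SS w)).
Local Notation c := (m%:R - 1 - d%:R : R).

Let m0 : (0 < m)%N. Proof. exact: leq_trans hm. Qed.

Let c0 : 0 < c.
Proof.
have : d%:R + 1 < m%:R :> R by rewrite natr1 ltr_nat -addn1.
by lra.
Qed.

Lemma measurable_ridge_trace e : measurable_fun setT (t e).
Proof.
rewrite /mxtrace; apply: measurable_sum => i.
exact: (measurable_functional_sketch S (@mx_measurable_ridge R m n d A e i i)).
Qed.

Section positive.
Variable e : R.
Hypothesis e0 : 0 < e.

Let it := integrable_trace hS m0 kerA e0.
Let ig := integrable_residual_trace hS m0 kerA e0.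

Lemma integrable_trace_sqr :
  P.-integrable setT (EFin \o (fun w => e * t e w ^+ 2)).
Proof.
apply: (@le_integrable _ _ _ P setT measurableT _ (EFin \o (fun w => d%:R * t e w))).
- apply/measurable_EFinP; apply: measurable_funM => //.
  by apply: measurable_funX; exact: measurable_ridge_trace.
- move=> w _; rewrite lee_fin.
  have t0 := trace_ridge_ge0 kerA (SS w) e0.
  have te := trace_ridge_le kerA (SS w) e0.
  rewrite !ger0_norm ?mulr_ge0 ?sqr_ge0 ?(ltW e0)//.
  by rewrite expr2 mulrA ler_wpM2r.
- exact: integrableZr_EFin.
Qed.

(** [stein_trace] rewritten in terms of the three quantities whose limits are known, using
    e q = t - (t - e q). *)
Lemma trace_moment :
  d%:R - e * \int[P]_w t e w = m%:R^-1 *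
    ((c + 1) * \int[P]_w t e w - \int[P]_w g e w + \int[P]_w (e * t e w ^+ 2)).
Proof.
have := stein_trace hS m0 kerA e0.
rewrite RintegralB//; last 2 first.
- exact: finite_measure_integrable_cst.
- exact: integrableZr_EFin.
rewrite RintegralZl// Rintegral_cst//. rewrite [fine _](congr1 fine (probability_setT P)) mulr1 => ->; congr (_ * _).
rewrite -RintegralZl// -RintegralB//; last exact: integrableZr_EFin.
rewrite -RintegralD//; last 2 first.
- by apply: integrableB_EFin => //; exact: integrableZr_EFin.
- exact: integrable_trace_sqr.
by apply: eq_Rintegral => w _; ring.
Qed.

Lemma trace_moment_le : \int[P]_w t e w <= m%:R * d%:R / c.
Proof.
have a0 : 0 <= \int[P]_w t e w.
  by apply: Rintegral_ge0 => w _; exact: trace_ridge_ge0.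
have s0 : 0 <= \int[P]_w (e * t e w ^+ 2).
  by apply: Rintegral_ge0 => w _; rewrite mulr_ge0 ?sqr_ge0 ?(ltW e0).
have ga : \int[P]_w g e w <= \int[P]_w t e w.
  apply: le_Rintegral => // w _; rewrite gerBl mulr_ge0 ?(ltW e0)//.
  exact: frob_ge0.
have mR : 0 < m%:R :> R by rewrite ltr0n.
have := trace_moment => /(congr1 (fun x => m%:R * x)).
rewrite mulrA divff ?gt_eqF// mul1r => E.
rewrite ler_pdivlMr//.
have := mulr_ge0 (ltW e0) a0; nra.
Qed.

End positive.

(** On the singular event 1 <= n^2 e tr L_e, so its probability is at most e K for all
    e > 0, where K = n^2 m d / (m - d - 1). *)
Lemma ridge_gram_ae_unit : {ae P, forall w, ridge_gram A 0 (SS w) \in unitmx}.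
Proof.
pose Z := [set w | \det (ridge_gram A 0 (SS w)) = 0].
have mg : mx_measurable (fun s : dom => ridge_gram A 0 s) by exact: mx_measurable_ridge_gram.
have mZ : measurable Z.
  rewrite -[Z]setTI; have := measurable_functional_sketch S (measurable_functional_det mg).
  by move=> H; exact: (H measurableT [set 0]).
exists Z; split => //; last first.
  move=> w /= /negP; rewrite unitmxE unitfE negbK => /eqP; exact.
have Pfin : P Z \is a fin_num by exact: fin_num_measure.
have p0 : 0 <= fine (P Z) by exact: fine_ge0.
rewrite -(fineK Pfin); congr EFin; apply/eqP; rewrite eq_le p0 andbT leNgt; apply/negP => pp.
pose K := n%:R ^+ 2 * (m%:R * d%:R / c).
have K0 : 0 <= K by rewrite mulr_ge0 ?sqr_ge0// divr_ge0 ?mulr_ge0// ltW.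
(* this e makes the bound e K smaller than the probability itself *)
pose e := fine (P Z) / (K + 1).
have K1 : 0 < K + 1 by rewrite ltr_wpDl.
have e0 : 0 < e by rewrite divr_gt0.
have : fine (P Z) <= e * K.
  have -> : fine (P Z) = \int[P]_w \1_Z w by rewrite /Rintegral integral_indic// setIT.
  apply: (@le_trans _ _ (\int[P]_w (n%:R ^+ 2 * e * t e w))).
    apply: le_Rintegral => //.
    - exact: integrable_indic.
    - by apply: integrableZr_EFin; exact: integrable_trace.
    - move=> w _; rewrite indicE.
      have [Zw|Zw] := pselect (Z w).
        rewrite mem_set// -mulrA; apply: (ridge_singular kerA e0).
        by rewrite unitmxE unitfE negbK; apply/eqP.
      rewrite memNset// -mulrA mulr_ge0 ?sqr_ge0// mulr_ge0 ?(ltW e0)//.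
      exact: trace_ridge_ge0.
  rewrite RintegralZl//; last exact: integrable_trace.
  rewrite /K [leRHS]mulrCA -[leLHS]mulrA; apply: ler_wpM2l; first exact: sqr_ge0.
  by apply: ler_wpM2l; [exact: ltW|exact: trace_moment_le].
have : e * (K + 1) = fine (P Z) by rewrite /e divfK// gt_eqF.
by rewrite mulrDr mulr1 => <-; rewrite gerDl leNgt e0.
Qed.

Local Notation e_ k := (k.+1%:R^-1 : R).

Let ek k : 0 < e_ k. Proof. by rewrite invr_gt0. Qed.

Let cvg_trace w : ridge_gram A 0 (SS w) \in unitmx ->
  t (e_ k) w @[k --> \oo] --> t 0 w.
Proof.
move=> uw; rewrite /mxtrace; apply: cvg_big => [|i _]; first exact: add_continuous.
have := @ridge_cvg R m n d A kerA (SS w) n 1%:M i i uw; rewrite mulmx1; under eq_fun do rewrite mulmx1.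
by apply.
Qed.

Let cvg_e : e_ k @[k --> \oo] --> (0 : R).
Proof. exact: cvg_harmonic. Qed.

Let trace_le k w : ridge_gram A 0 (SS w) \in unitmx -> t (e_ k) w <= t 0 w.
Proof.
move=> uw; apply: le_trans (trace_ridge0_ge kerA (ek k) uw).
by rewrite lerDl mulr_ge0 ?(ltW (ek k))// frob_ge0.
Qed.

Let it k := integrable_trace hS m0 kerA (ek k).
Let ig k := integrable_residual_trace hS m0 kerA (ek k).

Let it0 : P.-integrable setT (EFin \o t 0).
Proof.
apply: (integrable_fatou (f_ := fun k => t (e_ k)) it (measurable_ridge_trace 0) _
  (K := m%:R * d%:R / c)).
- by apply: filterS ridge_gram_ae_unit => w; exact: cvg_trace.
- by move=> k w; exact: trace_ridge_ge0.
- by move=> k; exact: trace_moment_le.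
Qed.

Let cvg_t : \int[P]_w t (e_ k) w @[k --> \oo] --> \int[P]_w t 0 w.
Proof.
apply: (cvg_Rintegral (f_ := fun k => t (e_ k)) it (measurable_ridge_trace 0) _ it0).
- by apply: filterS ridge_gram_ae_unit => w; exact: cvg_trace.
- apply: filterS ridge_gram_ae_unit => w uw k.
  by rewrite ger0_norm ?trace_le// trace_ridge_ge0.
Qed.

Let g_ge k w : ridge_gram A 0 (SS w) \in unitmx -> 2 * t (e_ k) w - t 0 w <= g (e_ k) w.
Proof. by move=> uw; have := trace_ridge0_ge kerA (ek k) uw; move: (_ * frob A _ _) => q /=; lra. Qed.

Let g_le k w : g (e_ k) w <= t (e_ k) w.
Proof. by rewrite gerBl mulr_ge0 ?(ltW (ek k))// frob_ge0. Qed.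

Let cvg_g : \int[P]_w g (e_ k) w @[k --> \oo] --> \int[P]_w t 0 w.
Proof.
apply: (cvg_Rintegral (f_ := fun k => g (e_ k)) ig (measurable_ridge_trace 0) _ it0).
- apply: filterS ridge_gram_ae_unit => w uw.
  apply: (@squeeze_cvgr _ _ _ _ (fun k => 2 * t (e_ k) w - t 0 w) (fun k => t (e_ k) w)).
  + by near=> k; rewrite g_le g_ge.
  + rewrite [X in _ --> X](_ : t 0 w = 2 * t 0 w - t 0 w); last by ring.
    apply: cvgB; last exact: cvg_cst.
    by apply: cvgM; [exact: cvg_cst|exact: cvg_trace].
  + exact: cvg_trace.
- apply: filterS ridge_gram_ae_unit => w uw k.
  by rewrite ger0_norm ?trace_sub_frob_ge0// (le_trans (g_le _ _))// trace_le.
Unshelve. all: by end_near. Qed.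

Let cvg_s : \int[P]_w (e_ k * t (e_ k) w ^+ 2) @[k --> \oo] --> (0 : R).
Proof.
have -> : (0 : R) = \int[P]_w cst 0 w by rewrite Rintegral_cst// mul0r.
apply: (@cvg_Rintegral _ T R P (fun k w => e_ k * t (e_ k) w ^+ 2) (cst 0) _ _ _
  (fun w => d%:R * t 0 w)).
- by move=> k; exact: integrable_trace_sqr.
- exact: measurable_cst.
- apply: filterS ridge_gram_ae_unit => w uw.
  rewrite /cst -[X in _ --> X](mul0r (t 0 w ^+ 2)).
  apply: cvgM => //; under eq_fun do rewrite expr2; rewrite expr2.
  by apply: cvgM; exact: cvg_trace.
- exact: integrableZr_EFin.
- apply: filterS ridge_gram_ae_unit => w uw k.
  have t0 := trace_ridge_ge0 kerA (SS w) (ek k).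
  rewrite /= ger0_norm; last by apply: mulr_ge0; [exact: ltW|exact: sqr_ge0].
  rewrite expr2 mulrA; apply: ler_pM => //.
  - by apply: mulr_ge0 => //; exact: ltW.
  - exact: trace_ridge_le.
  - exact: trace_le.
Qed.

(** As t 0 is the trace of W^-1 A^T A, this is the mean of an inverse Wishart matrix: in
    [trace_moment] all terms carrying a factor e disappear in the limit. *)
Lemma trace_inverse_gram : \int[P]_w t 0 w = m%:R * d%:R / c.
Proof.
set tau := \int[P]_w _.
have lhs : d%:R - e_ k * \int[P]_w t (e_ k) w @[k --> \oo] --> (d%:R : R).
  rewrite -[X in _ --> X]subr0 -(mul0r tau).
  by apply: cvgB; [exact: cvg_cst|exact: cvgM].
have rhs : m%:R^-1 * ((c + 1) * \int[P]_w t (e_ k) w - \int[P]_w g (e_ k) w +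
    \int[P]_w (e_ k * t (e_ k) w ^+ 2)) @[k --> \oo] --> m%:R^-1 * ((c + 1) * tau - tau + 0).
  apply: cvgM; first exact: cvg_cst.
  apply: cvgD => //; apply: cvgB => //.
  by apply: cvgM; first exact: cvg_cst.
have lhs2 : d%:R - e_ k * \int[P]_w t (e_ k) w @[k --> \oo] -->
    m%:R^-1 * ((c + 1) * tau - tau + 0).
  by under eq_fun do rewrite (trace_moment (ek _)); exact: rhs.
have E : d%:R = m%:R^-1 * ((c + 1) * tau - tau + 0) by exact: cvg_unique lhs lhs2.
have mR : m%:R != 0 :> R by rewrite pnatr_eq0 -lt0n.
move/(congr1 (fun x => m%:R * x)) : E; rewrite mulrA divff// mul1r addr0 => ->.
by rewrite (_ : _ - tau = tau * c); [rewrite mulfK// gt_eqF|ring].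
Qed.

Section residual.
Variable r : 'cV[R]_n.
Hypothesis Ar : A^T *m r = 0.
Local Notation Y e := (fun w => \sum_i ridge_fit A e r (SS w) i 0 ^+ 2).
Local Notation rho := (\sum_j r j 0 ^+ 2).

Lemma measurable_sqr_ridge_fit e : measurable_fun setT (Y e).
Proof.
apply: measurable_sum => i; apply: measurable_funX.
have mid := @mx_measurable_id R m n.
have mr : mx_measurable (fun s : dom => s *m r).
  by apply: mx_measurableM => //; exact: mx_measurable_cst.
have mp : mx_measurable (fun s : dom => ridge_fit A e r s).
  apply: (mx_measurableM (@mx_measurable_ridge R m n d A e)).
  by apply: mx_measurableM => //; exact: mx_measurable_tr.
exact: (measurable_functional_sketch S (mp i 0)).
Qed.

Lemma integrable_sqr_ridge_fit k : P.-integrable setT (EFin \o Y (e_ k)).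
Proof.
pose G (s : dom) := (sketch_ridge A (e_ k) s)^T *m (s *m r).
have GE s : ridge_fit A (e_ k) r s = G s.
  by rewrite /ridge_fit /G /sketch_ridge trmx_mul ridge_tr ?ridge_gram_unit// !mulmxA.
have mG : mx_measurable G.
  apply: mx_measurableM; first by apply: mx_measurable_tr; exact: sketch_ridge_measurable.
  by apply: mx_measurableM; [exact: mx_measurable_id|exact: mx_measurable_cst].
have gG : mx_growth 1 G.
  have gH : mx_growth 0 (sketch_ridge A (e_ k) : dom -> _) by exact: sketch_ridge_growth.
  exact: (mx_growthM (mx_growth_tr gH) (mx_growthM (@mx_growth_id _ _ _) (mx_growth_cst m n r))).
have -> : Y (e_ k) = fun w => ((G (SS w))^T *m G (SS w)) 0 0.
  by apply/funext => w; rewrite sumsq_mulmx; apply: eq_bigr => i _; rewrite GE.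
apply: (integrable_mx_growth hS m0 (k := 2) (F := fun s => (G s)^T *m G s)) => //.
  by apply: mx_measurableM => //; exact: mx_measurable_tr.
exact: (mx_growthM (mx_growth_tr gG) gG).
Qed.

(** [stein_residual] passes to the limit: Fatou's lemma makes the squared norm for e = 0
    integrable, and by contraction it dominates those for e > 0. *)
Lemma expected_sqr_ridge_fit : \int[P]_w Y 0 w = rho * (d%:R / c) /\
   P.-integrable setT (EFin \o Y 0).
Proof.
have YE k := stein_residual hS m0 kerA (ek k) Ar.
have ae_cvg : {ae P, forall w, Y (e_ k) w @[k --> \oo] --> Y 0 w}.
  apply: filterS ridge_gram_ae_unit => w uw.
  apply: cvg_big => [|i _]; first exact: add_continuous.
  under eq_fun do rewrite expr2; rewrite expr2.
  by apply: cvgM; exact: ridge_cvg.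
have rho0 : 0 <= rho by apply: sumr_ge0 => i _; exact: sqr_ge0.
have iY0 : P.-integrable setT (EFin \o Y 0).
  apply: (integrable_fatou (f_ := fun k => Y (e_ k)) integrable_sqr_ridge_fit (measurable_sqr_ridge_fit 0) ae_cvg
    (K := rho * m%:R^-1 * (m%:R * d%:R / c))).
  - by move=> k w; apply: sumr_ge0 => i _; exact: sqr_ge0.
  - move=> k; rewrite YE; apply: ler_wpM2l; first by rewrite mulr_ge0// invr_ge0.
    apply: le_trans (trace_moment_le (ek k)).
    by apply: le_Rintegral => // w _; exact: g_le.
split=> //.
have c1 : \int[P]_w Y (e_ k) w @[k --> \oo] --> \int[P]_w Y 0 w.
  apply: (cvg_Rintegral (f_ := fun k => Y (e_ k)) integrable_sqr_ridge_fit (measurable_sqr_ridge_fit 0) ae_cvg iY0).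
  apply: filterS ridge_gram_ae_unit => w uw k.
  rewrite ger0_norm; last by apply: sumr_ge0 => i _; exact: sqr_ge0.
  exact: ridge_contract.
have c2 : \int[P]_w Y (e_ k) w @[k --> \oo] --> rho * m%:R^-1 * \int[P]_w t 0 w.
  under eq_fun do rewrite YE.
  by apply: cvgM; first exact: cvg_cst.
have -> : \int[P]_w Y 0 w = rho * m%:R^-1 * \int[P]_w t 0 w by exact: cvg_unique c1 c2.
rewrite trace_inverse_gram.
have mR : m%:R != 0 :> R by rewrite pnatr_eq0 -lt0n.
by field; rewrite mR gt_eqF.
Qed.

End residual.
End expectation_limits.

(** * Least squares *)

Section least_squares.
Context (R : realType).

Lemma sqr_norm2 k (v : 'cV[R]_k) : norm2 v ^+ 2 = \sum_i v i 0 ^+ 2.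
Proof. by rewrite sqr_sqrtr// sumr_ge0// => i _; exact: sqr_ge0. Qed.

Lemma sqr_norm2_mx k (v : 'cV[R]_k) : norm2 v ^+ 2 = (v^T *m v) 0 0.
Proof. by rewrite sqr_norm2 sumsq_mulmx. Qed.

Lemma sqr_norm2D k (u v : 'cV[R]_k) :
  norm2 (u + v) ^+ 2 = norm2 u ^+ 2 + 2 * (u^T *m v) 0 0 + norm2 v ^+ 2.
Proof.
rewrite !sqr_norm2 [(u^T *m v) 0 0]mxE mulr_sumr -!big_split/=.
by apply: eq_bigr => i _; rewrite !mxE; ring.
Qed.

Lemma norm2_eq0 k (v : 'cV[R]_k) : norm2 v ^+ 2 = 0 -> v = 0.
Proof.
rewrite sqr_norm2 => /eqP; rewrite psumr_eq0 => [/allP v0|i _]; last exact: sqr_ge0.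
apply/matrixP => i j; rewrite ord1 [RHS]mxE.
by have := v0 i (mem_index_enum _); rewrite sqrf_eq0 => /eqP.
Qed.

(** If the gradient direction g = B^T (B x - c) were nonzero, the step - t g with
    t = |g|^2 / (|B g|^2 + 1) would decrease the objective. *)
Lemma argmin_normal (p q : nat) (B : 'M[R]_(p, q)) (c : 'cV[R]_p) x :
  argmin (lsq B c) x -> B^T *m (B *m x - c) = 0.
Proof.
move=> xmin; set u := B *m x - c; set g := B^T *m u.
apply: norm2_eq0.
set a := norm2 g ^+ 2; set b := norm2 (B *m g) ^+ 2.
have step t : 2 * t * a <= t ^+ 2 * b.
  have := xmin (x + (- t) *: g); rewrite /lsq.
  have -> : B *m (x + (- t) *: g) - c = u + (- t) *: (B *m g).
    by rewrite mulmxDr -scalemxAr addrAC.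
  rewrite -/u [leRHS]sqr_norm2D.
  have -> : (u^T *m ((- t) *: (B *m g))) 0 0 = - t * a.
    rewrite -scalemxAr mxE; congr (_ * _).
    by rewrite /a sqr_norm2_mx /g trmx_mul trmxK !mulmxA.
  have -> : norm2 ((- t) *: (B *m g)) ^+ 2 = t ^+ 2 * b.
    rewrite /b !sqr_norm2 mulr_sumr; apply: eq_bigr => i _.
    by rewrite mxE; ring.
  lra.
have a0 : 0 <= a by exact: sqr_ge0.
have b0 : 0 <= b by exact: sqr_ge0.
have b1 : 0 < b + 1 by rewrite ltr_wpDl.
apply/eqP; rewrite eq_le a0 andbT leNgt; apply/negP => ap.
have := step (a / (b + 1)).
have -> : 2 * (a / (b + 1)) * a = a ^+ 2 / (b + 1) ^+ 2 * (2 * (b + 1)).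
  by field; rewrite gt_eqF.
have -> : (a / (b + 1)) ^+ 2 * b = a ^+ 2 / (b + 1) ^+ 2 * b.
  by field; rewrite gt_eqF.
rewrite ler_pM2l; last by apply: divr_gt0; apply: exprn_gt0.
by lra.
Qed.

Lemma unique_argmin_ker0 (p q : nat) (B : 'M[R]_(p, q)) (c : 'cV[R]_p) x :
  argmin (lsq B c) = [set x] -> forall v : 'cV[R]_q, B *m v = 0 -> v = 0.
Proof.
move=> xuniq v Bv.
have xmin : argmin (lsq B c) x by rewrite xuniq.
have : argmin (lsq B c) (x + v).
  by move=> y; rewrite /lsq mulmxDr Bv addr0; exact: xmin.
by rewrite xuniq => /= /eqP; rewrite -subr_eq0 addrAC subrr add0r => /eqP.
Qed.

Lemma lsq_pythagoras (p q : nat) (B : 'M[R]_(p, q)) (c : 'cV[R]_p) x y :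
  argmin (lsq B c) x -> lsq B c y = norm2 (B *m (y - x)) ^+ 2 + lsq B c x.
Proof.
move=> /argmin_normal nx; rewrite /lsq.
have -> : B *m y - c = B *m (y - x) + (B *m x - c) by rewrite mulmxBr addrA subrK.
by rewrite sqr_norm2D trmx_mul -mulmxA nx mulmx0 mxE mulr0 addr0.
Qed.

Lemma sketched_solution (m n d : nat) (A : 'M[R]_(n, d)) (b : 'cV[R]_n)
    (s : 'M[R]_(m, n)) x y : ridge_gram A 0 s \in unitmx ->
  argmin (lsq (s *m A) (s *m b)) y ->
  A *m (y - x) = ridge_fit A 0 (b - A *m x) s.
Proof.
move=> us /argmin_normal ny.
have E : ridge_gram A 0 s *m (y - x) = A^T *m (s^T *m (s *m (b - A *m x))).
  have D : s *m A *m (y - x) - s *m (b - A *m x) = s *m A *m y - s *m b.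
    by rewrite mulmxBr [s *m (b - _)]mulmxBr opprB addrA mulmxA subrK.
  move: ny; rewrite -D mulmxBr => /subr0_eq ny.
  by rewrite /ridge_gram scale0r addr0 -mulmxA ny trmx_mul -mulmxA.
rewrite /ridge_fit ridgeE// -!mulmxA -E [invmx _ *m _]mulmxA mulVmx// mul1mx.
by [].
Qed.

End least_squares.

Theorem mainTheorem1 (R : realType) (n d m : nat)
    (A : 'M[R]_(n, d)) (b : 'cV[R]_n) (xstar : 'cV[R]_d)
    (hxstar : argmin (lsq A b) = [set xstar])
    (hm : (d + 1 < m)%N)
    (disp : measure_display) (T : measurableType disp) (P : probability T R)
    (S : 'I_m -> 'I_n -> {RV P >-> R})
    (hS : gaussian_sketch S)
    (xhat : T -> 'cV[R]_d)
    (hxhat_meas : forall k : 'I_d,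
       measurable_fun [set: T] (fun w => xhat w k 0))
    (hxhat : {ae P, forall w,
       argmin (lsq (sketch_mx S w *m A) (sketch_mx S w *m b)) (xhat w)}) :
  ('E_P[fun w => (norm2 (A *m (xhat w - xstar)) ^+ 2)%R] =
     'E_P[fun w => lsq A b (xhat w)] - (lsq A b xstar)%:E)%E /\
  ('E_P[fun w => lsq A b (xhat w)] - (lsq A b xstar)%:E =
     (lsq A b xstar * (d%:R / (m%:R - d%:R - 1)))%:E)%E.
Proof.
have kerA := unique_argmin_ker0 hxstar.
have xmin : argmin (lsq A b) xstar by rewrite hxstar.
pose r := b - A *m xstar.
have Ar : A^T *m r = 0.
  by rewrite /r -opprB mulmxN (argmin_normal xmin) oppr0.
have rho : \sum_j r j 0 ^+ 2 = lsq A b xstar.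
  rewrite /lsq sqr_norm2; apply: eq_bigr => j _.
  by rewrite -[LHS]sqrrN /r; congr (_ ^+ 2); rewrite !mxE opprB.
pose err w := norm2 (A *m (xhat w - xstar)) ^+ 2.
have err0 w : 0 <= err w by exact: sqr_ge0.
have merr : measurable_fun setT err.
  have -> : err = fun w => \sum_i (\sum_k A i k * (xhat w k 0 - xstar k 0)) ^+ 2.
    apply/funext => w; rewrite /err sqr_norm2; apply: eq_bigr => i _.
    by rewrite mxE; congr (_ ^+ 2); apply: eq_bigr => k _; rewrite !mxE.
  apply: measurable_sum => i; apply: measurable_funX.
  apply: measurable_sum => k; apply: measurable_funM => //.
  exact: measurable_funB.
have errE : (\int[P]_w (err w)%:E = (lsq A b xstar * (d%:R / (m%:R - d%:R - 1)))%:E)%E.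
  have [Y0 iY0] := expected_sqr_ridge_fit hS hm kerA Ar.
  transitivity (\int[P]_w (\sum_i ridge_fit A 0 r (sketch_mx S w) i 0 ^+ 2)%:E)%E.
    apply: ae_eq_integral => //.
    - exact/measurable_EFinP.
    - exact: measurable_int iY0.
    - apply: filterS2 hxhat (ridge_gram_ae_unit hS hm kerA) => w xw uw _.
      by rewrite /err (sketched_solution xstar uw xw) sqr_norm2.
  rewrite -(fineK (integrable_fin_num measurableT iY0)); congr EFin.
  by rewrite -rho -addrA -opprD [d%:R + 1]addrC opprD addrA; exact: Y0.
have lsqE : ('E_P[fun w => lsq A b (xhat w)] = \int[P]_w (err w)%:E + (lsq A b xstar)%:E)%E.
  rewrite unlock.
  under eq_integral do rewrite (lsq_pythagoras _ xmin) EFinD.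
  rewrite ge0_integralD//.
  - by congr (_ + _)%E; have := expectation_cst P (lsq A b xstar); rewrite unlock.
  - by move=> w _; rewrite lee_fin; exact: err0.
  - exact/measurable_EFinP.
  - by move=> w _; rewrite lee_fin sqr_ge0.
have subE : ('E_P[fun w => lsq A b (xhat w)] - (lsq A b xstar)%:E = \int[P]_w (err w)%:E)%E.
  by rewrite lsqE addeK.
by rewrite subE -errE unlock.
Qed.
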